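(* Let $(\Omega,\mathcal{A},\mu)$ be a probability space, where $\mathcal{A}$ is a $\mu$-complete $\sigma$-algebra, let $A$ be a compact metric space and let $n\in\mathbb{N}$, $n\geq 1$. Consider a function $V=(V_1,\dots,V_n):\Omega\times A\rightarrow \mathbb{R}^n$ such that $V(\cdot,a)$ is measurable for every $a\in A$ and $V(\omega,\cdot)$ is continuous on $A$ for every $\omega\in\Omega$. Assume further that $V_i$ is $L^1$-bounded for every $i$, and that $\mathscr{C}\subset\mathcal{A}$ is a sub-$\sigma$-algebra which is $\mu$-coarser than $\mathcal{A}$. Then, for every $\delta\in \mathcal{R}(\Omega,A)$, there exists a measurable function $f:\Omega\rightarrow A$ such that - $\mathbb{E}(\delta.V|\mathscr{C})=\mathbb{E}(f.V|\mathscr{C})$ ($\mu$-a.e.), and - $f(\omega)\in \mathrm{supp}(\delta_\omega)$ for $\mu$-a.e. $\omega\in \Omega$.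
   Context: $\mathcal{A}^+$ denotes the set of $E\in\mathcal{A}$ with $\mu(E)>0$. For a sub-$\sigma$-algebra $\mathscr{C}\subset\mathcal{A}$ and $E\in\mathcal{A}$, $\mathscr{C}_E=\{B\cap E: B\in\mathscr{C}\}$. $\mathscr{C}$ is said to be $\mu$-coarser than $\mathcal{A}$ iff for every $E\in\mathcal{A}^+$ there exists $E_0\in\mathcal{A}$, $E_0\subset E$, such that $\mu(F\Delta E_0)>0$ for all $F\in\mathscr{C}_E$ ($\Delta$ is the symmetric difference). Topological spaces carry their Borel $\sigma$-algebras. $\mathcal{R}(\Omega,A)$ is the space of Young measures: the set of functions $\delta:\Omega\to\mathbb{P}(A)$, $\omega\mapsto\delta_\omega$, where $\mathbb{P}(A)$ is the set of Borel probability measures on $A$, such that $\omega\mapsto\delta_\omega(B)$ is $\mathcal{A}$-measurable for every Borel set $B\subset A$. $\mathrm{supp}(\delta_\omega)$ is the topological support of $\delta_\omega$. A function $\phi:\Omega\times A\to\mathbb{R}$ is $L^1$-bounded if there is a $\mu$-integrable $h:\Omega\to\mathbb{R}_+$ with $|\phi(\omega,x)|\le h(\omega)$ for all $(\omega,x)\in\Omega\times A$. For $\delta\in\mathcal{R}(\Omega,A)$, $\delta.V$ is the function on $\Omega$ given by $\delta.V(\omega)=\int_A V(\omega,a)\,d\delta_\omega(a)$; for measurable $f:\Omega\to A$, $f.V(\omega)=V(\omega,f(\omega))$. $\mathbb{E}(\cdot|\mathscr{C})$ is the (coordinatewise) conditional expectation given $\mathscr{C}$ under $\mu$. *)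

(* Defs.v *)
From HB Require Import structures.
From mathcomp Require Import all_boot all_order all_algebra.
From mathcomp Require Import all_classical all_reals all_analysis.
From mathcomp Require Import measurable_realfun.

Set Implicit Arguments.
Unset Strict Implicit.
Unset Printing Implicit Defensive.

Import Order.TTheory GRing.Theory Num.Theory.
Import numFieldNormedType.Exports.

Local Open Scope classical_set_scope.
Local Open Scope ring_scope.

(* Measurable types are pointed, so the Borel sigma-algebra of a metric space
   is only available when the space has a distinguished point. *)
#[short(type="pmetricType")]
HB.structure Definition PMetric (K : numDomainType) :=
  { M of Metric K M & isPointed M }.

Notation borel X := (g_sigma_algebraType (@open X)).

Section definitions.
Context d (T : measurableType d) (R : realType) (P : probability T R).

Definition trace_sigma (C : set (set T)) (E : set T) : set (set T) :=
  [set B `&` E | B in C].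

Definition mu_coarser (C : set (set T)) : Prop :=
  forall E, measurable E -> (0 < P E)%E ->
    exists E0, [/\ measurable E0, E0 `<=` E &
      forall F, trace_sigma C E F -> (0 < P (F `+` E0))%E].

Definition L1_bounded (A : Type) (phi : T -> A -> R) : Prop :=
  exists h : T -> R, [/\ P.-integrable setT (EFin \o h),
    forall w, 0 <= h w & forall w x, `|phi w x| <= h w].

(* Y is a version of the conditional expectation of X given C. *)
Definition is_condexp (C : set (set T)) (X Y : T -> R) : Prop :=
  [/\ measurable_fun setT (Y : g_sigma_algebraType C -> R),
      P.-integrable setT (EFin \o Y) &
      forall B, C B ->
        (\int[P]_(w in B) (Y w)%:E = \int[P]_(w in B) (X w)%:E)%E].

(* A chosen version; one exists for every integrable X, see condexpP. *)
Definition condexp (C : set (set T)) (X : T -> R) : T -> R :=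
  xget (cst 0) [set Y | is_condexp C X Y].

Definition vcondexp n (C : set (set T)) (X : T -> 'rV[R]_n) : T -> 'rV[R]_n :=
  fun w => \row_i condexp C (fun w' => X w' ord0 i) w.

Lemma condexpP (C : set (set T)) (X : T -> R) :
  sigma_algebra setT C -> C `<=` measurable ->
  P.-integrable setT (EFin \o X) -> is_condexp C X (condexp C X).
Proof.
move=> sC CA iX; rewrite /condexp.
apply: (@xgetPex _ (cst 0) [set Y | is_condexp C X Y]).
pose TC : measurableType _ := g_sigma_algebraType C.
have mE (B : set TC) : measurable B = C B.
  by rewrite -[in RHS](measurable_g_measurableTypeE sC).
pose i : T -> TC := fun w => w.
have mi : measurable_fun setT i.
  by move=> _ B; rewrite mE setTI => /CA.
pose iM : {mfun T >-> TC} := HB.pack_for {mfun T >-> TC} i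
  (isMeasurableFun.Build _ _ _ _ i mi).
pose nu0 : {charge set T -> \bar R} := induced_charge iX.
pose nu_ : {charge set TC -> \bar R} := pushforward nu0 i.
pose nu := nu_ mi.
pose mu : probability TC R := distribution P iM.
have numu : nu `<< mu.
  apply/null_content_dominatesP => B mB muB0.
  rewrite /nu/= /pushforward /nu0 /induced_charge.
  have mB' : d.-measurable (i @^-1` B) by apply: CA; rewrite -mE.
  apply: null_set_integral => //.
  exact: (measurable_funS measurableT _ (measurable_int _ iX)).
have imu := Radon_Nikodym_integrable numu.
have mY := measurable_int _ imu.
pose Y := fine \o Radon_Nikodym nu mu.
have YE : EFin \o Y = Radon_Nikodym nu mu.
  by apply/funext => x; rewrite /Y/= fineK// Radon_Nikodym_fin_num.
have iY : P.-integrable setT (EFin \o Y).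
  rewrite YE; apply/integrableP; split.
    exact: (measurableT_comp mY mi).
  have /integrableP[_] := imu.
  rewrite ge0_integral_pushforward//.
  exact: measurableT_comp.
exists Y; split => //.
- exact: measurableT_comp.
- move=> B CB; have mB : measurable (B : set TC) by rewrite mE.
  have -> : (\int[P]_(w in B) (X w)%:E)%E = nu B by [].
  rewrite (Radon_Nikodym_integral numu mB) integral_pushforward//.
    by apply: eq_integral => x _; rewrite /= -[in RHS]YE.
  rewrite -YE; apply: (integrableS measurableT) => //.
  exact: CA.
Qed.

End definitions.

Section young.
Context d (T : measurableType d) (R : realType).

(* A probability kernel is exactly a Young measure: w |-> delta w B is
   measurable for every Borel set B. *)
Definition young (A : ptopologicalType) := R.-pker T ~> borel A.

Definition young_app (A : ptopologicalType) n (delta : young A)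
    (V : T -> A -> 'rV[R]_n) : T -> 'rV[R]_n :=
  fun w => \row_i (\int[delta w]_x V w x ord0 i)%R.

End young.

Definition supp (A : ptopologicalType) (R : realType)
    (m : {measure set (borel A) -> \bar R}) : set A :=
  [set x | forall U : set A, open U -> U x -> (0 < m U)%E].

(* Main.v *)
Require Import Defs.
From HB Require Import structures.
From mathcomp Require Import all_boot all_order all_algebra.
From mathcomp Require Import all_classical all_reals all_analysis.
From mathcomp Require Import measurable_realfun.
From mathcomp Require Import ring lra.

Set Implicit Arguments.
Unset Strict Implicit.
Unset Printing Implicit Defensive.

Import Order.TTheory GRing.Theory Num.Theory.
Import numFieldNormedType.Exports.

Local Open Scope classical_set_scope.
Local Open Scope ring_scope.

(** The idea is to condition each [delta w] on smaller and smaller random sets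
    until a single point [f w] of its support is left, without ever changing the
    conditional expectations given [C] of the averages of the coordinates of [V].

    One step cuts the current fibre over [w] either to a fixed Borel set [U] or
    to its complement ([split_sections]). The average over the fibre is a convex
    combination of the averages over the two parts, with weight [lam w], the
    share of [U]. A conditional form of Lyapunov's theorem
    ([conditional_lyapunov]) replaces this weight by the indicator of a set [E]
    with the same conditional expectations; the fibre is cut to [U] over [E] and
    to the complement elsewhere. Running [U] through a countable base of [A]
    makes the fibres, all of positive mass, shrink to a point ([young_selection]).
    So [f w] is in the support of [delta w], continuity of [V w] makes the
    averages converge to [V w (f w)], and dominated convergence transfers the
    equality of conditional expectations to the limit.

    The conditional Lyapunov theorem rests on halving: for every measurable [E]
    and finitely many integrable [g i] there is [E'] included in [E] such that
    each [g i] has half the conditional expectation on [E'] that it has on [E]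
    ([conditional_half]). A weight is rounded to a set by paying out its binary
    digits one after the other, each time on half of the space that is left.
    For the constant density, halving is an exhaustion argument
    ([conditional_half_pr]) resting on the sets of small conditional probability
    that coarseness of [C] provides ([nonnull_half]). One more density is handled
    by bisection between a solution with too small and one with too large a
    conditional integral ([bisection_half]), where sets of [C] decide which end
    of the bracket to move. *)

(** * Set functions with an integrable density *)

(** Boolean identities and inclusions between sets, from the inclusions in the
    context: evaluated at a point, each set becomes a propositional atom, and
    these are decided by excluded middle. *)
Ltac set_tauto :=
  let x := fresh "x" in
  try (apply/seteqP; split); move=> x;
  repeat match goal with
  | H : _ `<=` _ |- _ => move: (H x); clear H
  end;
  rewrite /setU /setI /setD /setC /setT /set0 /mkset;
  repeat match goal with
  | |- context [?S x] => generalize (S x)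
  end;
  clear;
  repeat match goal with
  | |- forall _ : Prop, _ =>
    let p := fresh "p" in intro p;
    case: (pselect p) => [/propT->|/propF->]; clear p
  end;
  tauto.

Lemma half_expn_cvg0 (R : realType) (a : R) : (fun k => a / 2 ^+ k) @ \oo --> (0 : R).
Proof.
rewrite -[X in _ --> X](mulr0 a); apply: cvgM; first exact: cvg_cst.
under eq_fun do rewrite -exprVn.
by apply: cvg_expr; rewrite ger0_norm// invf_lt1// ltr1n.
Qed.

Section integral_set_function.
Context d (T : measurableType d) (R : realType) (P : probability T R).
Implicit Types (f g : T -> R) (A B S : set T).

Definition intble g := P.-integrable setT (EFin \o g).

Definition setint g S : R := \int[P]_(w in S) g w.

Lemma intbleS g S : measurable S -> intble g -> P.-integrable S (EFin \o g).
Proof. by move=> mS; apply: integrableS. Qed.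

Lemma intble_cst (r : R) : intble (cst r).
Proof. exact: finite_measure_integrable_cst. Qed.

Lemma intbleB g1 g2 : intble g1 -> intble g2 -> intble (fun w => g1 w - g2 w).
Proof. by move=> i1 i2; have := integrableB measurableT i1 i2. Qed.

Lemma intbleZ r g : intble g -> intble (fun w => r * g w).
Proof. by move=> i1; have := integrableZl measurableT r i1. Qed.

Lemma intble_meas g : intble g -> measurable_fun setT g.
Proof. by move=> /measurable_int/measurable_EFinP. Qed.

Lemma intble_le f g : measurable_fun setT f -> (forall w, `|f w| <= g w) ->
  intble g -> intble f.
Proof.
move=> mf fg ig; apply: (le_integrable measurableT _ _ ig) => //.
  exact/measurable_EFinP.
by move=> w _; rewrite /= lee_fin (le_trans (fg w))// ler_norm.
Qed.

Lemma intble_norm g : intble g -> intble (fun w => `|g w|).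
Proof. exact: integrable_norm. Qed.

Lemma intble_restr g S : measurable S -> intble g -> intble (g \_ S).
Proof.
move=> mS ig; have /(integrable_mkcond _ mS) := intbleS mS ig.
by rewrite /intble restrict_EFin.
Qed.

Lemma setint_restr g S B : setint (g \_ B) S = setint g (S `&` B).
Proof. by rewrite /setint Rintegral_mkcondr. Qed.

Lemma setintD g1 g2 S : measurable S -> intble g1 -> intble g2 ->
  setint (fun w => g1 w + g2 w) S = setint g1 S + setint g2 S.
Proof. by move=> mS i1 i2; rewrite /setint RintegralD//; exact: intbleS. Qed.

Lemma setintB g1 g2 S : measurable S -> intble g1 -> intble g2 ->
  setint (fun w => g1 w - g2 w) S = setint g1 S - setint g2 S.
Proof. by move=> mS i1 i2; rewrite /setint RintegralB//; exact: intbleS. Qed.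

Lemma setintZ r g S : measurable S -> intble g ->
  setint (fun w => r * g w) S = r * setint g S.
Proof. by move=> mS i1; rewrite /setint RintegralZl//; exact: intbleS. Qed.

Lemma setintU g A B : measurable A -> measurable B -> A `&` B = set0 ->
  intble g -> setint g (A `|` B) = setint g A + setint g B.
Proof.
move=> mA mB AB ig; rewrite /setint Rintegral_setU//.
  by apply: intbleS => //; exact: measurableU.
by apply/disj_setPS; rewrite AB.
Qed.

Lemma setint_split g S B : measurable S -> measurable B -> intble g ->
  setint g S = setint g (S `&` B) + setint g (S `\` B).
Proof.
move=> mS mB ig; rewrite -setintU//; first by congr setint; set_tauto.
- exact: measurableI.
- exact: measurableD.
- by set_tauto.
Qed.

Lemma setint0 g : setint g set0 = 0.
Proof. exact: Rintegral_set0. Qed.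

Lemma le_setint g1 g2 S : measurable S -> intble g1 -> intble g2 ->
  (forall w, S w -> g1 w <= g2 w) -> setint g1 S <= setint g2 S.
Proof. by move=> mS i1 i2 g12; apply: le_Rintegral => //; exact: intbleS. Qed.

Lemma le_setint_norm g S : measurable S -> intble g ->
  `|setint g S| <= setint (fun w => `|g w|) S.
Proof. by move=> mS ig; apply: le_normr_Rintegral => //; exact: intbleS. Qed.

Lemma setint_ge0 g S : (forall w, S w -> 0 <= g w) -> 0 <= setint g S.
Proof. exact: Rintegral_ge0. Qed.

Lemma setint_mono g A B : measurable A -> measurable B -> A `<=` B -> intble g ->
  (forall w, 0 <= g w) -> setint g A <= setint g B.
Proof.
move=> mA mB AB ig g0; rewrite (setint_split mB mA)//.
have -> : B `&` A = A by set_tauto.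
by rewrite lerDl; apply: setint_ge0.
Qed.

(** [P] as a real-valued set function, put in the form [setint] so that the
    additivity and continuity lemmas apply to it as well. *)
Definition probr S : R := setint (cst 1) S.

Lemma probrE S : measurable S -> (probr S)%:E = P S.
Proof.
move=> mS; rewrite /probr /setint Rintegral_cst// mul1r fineK//.
exact: fin_num_measure.
Qed.

Lemma probr_gt0 S : measurable S -> (0 < probr S) = (0 < P S)%E.
Proof. by move=> mS; rewrite -(probrE mS) lte_fin. Qed.

Lemma probr_ge0 S : 0 <= probr S.
Proof. by apply: setint_ge0. Qed.

Lemma probr_le A B : measurable A -> measurable B -> A `<=` B -> probr A <= probr B.
Proof. by move=> mA mB AB; apply: setint_mono => //; exact: intble_cst. Qed.

Lemma probr_le1 S : measurable S -> probr S <= 1.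
Proof. by move=> mS; rewrite -lee_fin probrE//; exact: probability_le1. Qed.

Lemma setint_small g (e : R) : intble g -> 0 < e ->
  exists2 dl : R, 0 < dl &
    forall S, measurable S -> probr S < dl -> setint (fun w => `|g w|) S < e.
Proof.
move=> ig e0; have [dl [dl0 H]] := integral_normr_continuous ig e0.
by exists dl => // S mS Sd; apply: H => //; have := probrE mS; rewrite /= => <-; rewrite lte_fin.
Qed.

(** Absolute continuity of the integral makes [setint g] continuous for the
    pseudometric [P (A `+` B)]. The sets [D_ k] only have to dominate both
    differences, which is how the nested constructions below deliver them. *)
Lemma setint_approx g (S : set T) (S_ D_ : (set T)^nat) : intble g ->
  measurable S -> (forall k, measurable (S_ k)) ->
  (forall k, measurable (D_ k)) ->
  (forall k, S `\` S_ k `<=` D_ k) -> (forall k, S_ k `\` S `<=` D_ k) ->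
  (fun k => probr (D_ k)) @ \oo --> 0 ->
  forall F, measurable F -> (fun k => setint g (F `&` S_ k)) @ \oo --> setint g (F `&` S).
Proof.
move=> ig mS mS_ mD SD1 SD2 D0 F mF; apply/cvgrPdist_lt => e e0.
have [dl dl0 H] := setint_small ig e0.
have /cvgrPdist_lt/(_ _ dl0) := D0; apply: filter_app; near=> k.
rewrite sub0r normrN ger0_norm ?probr_ge0// => /(H _ (mD k)) {}H.
have mI1 := measurableI _ _ mF mS; have mI2 := measurableI _ _ mF (mS_ k).
rewrite (setint_split mI1 (mS_ k))// (setint_split mI2 mS)//.
have -> : F `&` S_ k `&` S = F `&` S `&` S_ k by set_tauto.
rewrite opprD addrACA subrr add0r.
set A := _ `\` S_ k; set B := _ `\` S.
have mA : measurable A by exact: measurableD.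
have mB : measurable B by exact: measurableD.
apply: le_lt_trans H; apply: (le_trans (ler_normB _ _)).
apply: (@le_trans _ _ (setint (fun w => `|g w|) A + setint (fun w => `|g w|) B)).
  by apply: lerD; exact: le_setint_norm.
have ign := intble_norm ig.
rewrite -setintU//; last by rewrite /A /B; set_tauto.
apply: setint_mono => //; first exact: measurableU.
by rewrite /A /B; move: (SD1 k) (SD2 k) => ? ?; set_tauto.
Unshelve. all: by end_near. Qed.

Lemma bigcup_gap (X : (set T)^nat) : (forall k, measurable (X k)) ->
  nondecreasing_seq X -> (fun k => probr ((\bigcup_k X k) `\` X k)) @ \oo --> 0.
Proof.
move=> mX ndX; set U := \bigcup_k X k.
have mU : measurable U by exact: bigcup_measurable.
have eq k : probr (U `\` X k) = probr U - probr (X k).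
  have h := setint_split mU (mX k) (intble_cst 1).
  have UX : U `&` X k = X k.
    by have : X k `<=` U by [exact: bigcup_sup]; move=> ?; set_tauto.
  by rewrite UX in h; rewrite /probr h addrAC subrr add0r.
rewrite (_ : (fun k => _) = (fun k => probr U - probr (X k))); last exact/funext.
rewrite -[X in _ --> X](subrr (probr U)).
apply: cvgB; first exact: cvg_cst.
have h := nondecreasing_cvg_mu (mu := P) mX mU ndX.
have e := probrE mU; rewrite /= -/U in h e; rewrite -e in h.
move: h => /fine_cvg/=; apply: cvg_trans; apply: near_eq_cvg.
by apply: nearW => k /=; rewrite -[RHS]/(fine (probr (X k))%:E) probrE.
Qed.

End integral_set_function.

(** * Comparing conditional expectations, and small sets *)

Section conditional_halving.
Context d (T : measurableType d) (R : realType) (P : probability T R).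
Context (C : set (set T)) (sC : sigma_algebra [set: T] C)
  (CA : C `<=` measurable).
Implicit Types (f g : T -> R) (A B E F S : set T).
Local Notation nu := (setint P).
Local Notation pr := (probr P).
Local Notation intble := (intble P).

Let mE (B : set (g_sigma_algebraType C)) : measurable B = C B.
Proof. by rewrite -[in RHS](measurable_g_measurableTypeE sC). Qed.

Let CT : C setT.
Proof. by rewrite -mE. Qed.

Let CI A B : C A -> C B -> C (A `&` B).
Proof.
by rewrite -!mE; exact: (@measurableI _ (g_sigma_algebraType C)).
Qed.

Let CD A B : C A -> C B -> C (A `\` B).
Proof.
by rewrite -!mE; exact: (@measurableD _ (g_sigma_algebraType C)).
Qed.

(** [B] is the event that a version of the conditional expectation of
    [g1 - g2] is nonpositive. Here and below, statements about conditional
    expectations are written through integrals over the sets [F] of [C], which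
    avoids choosing versions and handling null sets. *)
Lemma condexp_compare g1 g2 : intble g1 -> intble g2 ->
  exists2 B, C B & forall F, C F ->
    nu g1 (F `&` B) <= nu g2 (F `&` B) /\ nu g2 (F `\` B) <= nu g1 (F `\` B).
Proof.
move=> i1 i2; have i12 := intbleB i1 i2.
have [] := condexpP sC CA i12; set Y := condexp _ _ _ => mY iY YE.
pose B := Y @^-1` `]-oo, 0]; have CB : C B.
  rewrite -mE -[B]setTI; apply: mY => //.
exists B => // F CF; have mF := CA CF; have mB := CA CB.
have XE S : C S -> nu Y S = nu g1 S - nu g2 S.
  move=> CS; rewrite -setintB//; last exact: CA.
  by rewrite /nu /setint /Rintegral YE.
split.
- rewrite -subr_le0 -XE; last exact: CI.
  rewrite -(setint_restr P Y F B) -(setint0 P (Y \_ B)).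
  have -> : nu (Y \_ B) set0 = nu (cst 0) F.
    by rewrite setint0 /setint Rintegral_cst// mul0r.
  apply: le_setint => //.
  + exact: intble_restr.
  + exact: intble_cst.
  + move=> w Fw; rewrite patchE; case: ifPn => //.
    by rewrite inE /B/= in_itv/=.
- rewrite -subr_ge0 -XE; last exact: CD.
  apply: setint_ge0 => w [Fw]; rewrite /B/= in_itv/= => /negP.
  by rewrite -ltNge => /ltW.
Qed.

Context (coarse : mu_coarser P C).

(** Coarseness provides [G0 `<=` G] that is not a trace of [C]. Take [Z] to be
    [G0] where [G0] has the smaller conditional probability, and its complement
    in [G] elsewhere; [Z] null would make [G0] a trace of [C] up to a null set. *)
Lemma nonnull_half G : measurable G -> 0 < pr G ->
  exists Z, [/\ measurable Z, Z `<=` G, 0 < pr Z &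
    forall F, C F -> pr (F `&` Z) <= pr (F `&` G) / 2].
Proof.
move=> mG; rewrite probr_gt0// => /(coarse mG)[G0 [mG0 G0G cG0]].
have i1 := intble_cst P 1.
have mGG0 : measurable (G `\` G0) by exact: measurableD.
have [B CB H] :=
  condexp_compare (intble_restr mG0 i1) (intble_restr mGG0 i1).
have mB := CA CB.
pose Z := (B `&` G0) `|` ((G `\` G0) `\` B).
have mZ : measurable Z.
  by apply: measurableU; [exact: measurableI|exact: measurableD].
exists Z; split => //.
- by rewrite /Z; set_tauto.
- rewrite probr_gt0//.
  have /cG0 : trace_sigma C G (G `\` B).
    exists (~` B); first by rewrite -setTD; exact: CD.
    by rewrite setIC setDE.
  congr (_ < P _)%E; rewrite /Z /setY; set_tauto.
- move=> F CF; have mF := CA CF.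
  have [] := H _ CF; rewrite !setint_restr -/(pr _) -/(pr _) => h1 h2.
  have prS S1 S2 : measurable S1 -> measurable S2 -> S1 `&` S2 = set0 ->
      pr (S1 `|` S2) = pr S1 + pr S2 by move=> *; exact: setintU.
  have m1 : measurable (F `&` B `&` G0) by apply: measurableI => //; exact: measurableI.
  have m2 : measurable (F `&` B `&` (G `\` G0)) by apply: measurableI => //; exact: measurableI.
  have m3 : measurable ((F `\` B) `&` G0).
    by apply: measurableI => //; exact: measurableD.
  have m4 : measurable ((F `\` B) `&` (G `\` G0)).
    by apply: measurableI => //; exact: measurableD.
  have -> : F `&` Z = (F `&` B `&` G0) `|` ((F `\` B) `&` (G `\` G0)).
    by rewrite /Z; set_tauto.
  have -> : F `&` G = ((F `&` B `&` G0) `|` (F `&` B `&` (G `\` G0))) `|`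
     (((F `\` B) `&` G0) `|` ((F `\` B) `&` (G `\` G0))) by set_tauto.
  have e1 := prS _ _ m1 m2 ltac:(set_tauto).
  have e2 := prS _ _ m3 m4 ltac:(set_tauto).
  rewrite (prS _ _ m1 m4 ltac:(set_tauto)) prS ?e1 ?e2; last 3 first.
  - exact: measurableU.
  - exact: measurableU.
  - by set_tauto.
  by rewrite ler_pdivlMr//; move: h1 h2; rewrite /probr; lra.
Qed.

Lemma nonnull_small k G : measurable G -> 0 < pr G ->
  exists Z, [/\ measurable Z, Z `<=` G, 0 < pr Z &
    forall F, C F -> pr (F `&` Z) <= pr (F `&` G) / 2 ^+ k].
Proof.
move=> mG G0; elim: k => [|k [Z [mZ ZG Z0 HZ]]].
  by exists G; split => // F _; rewrite expr0 divr1.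
have [Z' [mZ' ZZ' Z'0 HZ']] := nonnull_half mZ Z0.
exists Z'; split => //; first exact: subset_trans ZZ' ZG.
move=> F CF; apply: le_trans (HZ' F CF) _.
rewrite exprS invfM mulrA mulrAC ler_pM2r//; exact: HZ.
Qed.

(** Exhaustion: each step closes at least half of the gap to any member of the
    class lying above, so the union of the steps leaves no gap. *)
Lemma greedy_maximal (Q : set T -> Prop) : (exists X, Q X) ->
  (forall X, Q X -> measurable X) ->
  (forall X : (set T)^nat, (forall k, Q (X k)) -> nondecreasing_seq X ->
    Q (\bigcup_k X k)) ->
  exists X, Q X /\ forall Y, Q Y -> X `<=` Y -> pr Y <= pr X.
Proof.
move=> [X0 QX0] Qm Qcup.
have next X : {N | Q X -> [/\ Q N, X `<=` N &
    forall Y, Q Y -> X `<=` Y -> pr Y - pr N <= (pr Y - pr X) / 2]}.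
  apply: cid; have [QX|] := pselect (Q X); last by exists set0.
  pose V := [set pr Y | Y in [set Y | Q Y /\ X `<=` Y]].
  have VX : V (pr X) by exists X => //; split.
  have hV : has_sup V.
    split; first by exists (pr X).
    by exists 1 => _ [Y [QY _] <-]; exact/probr_le1/Qm.
  have [e0|e0] := leP (sup V) (pr X).
    exists X => _; split => // Y QY XY.
    have : pr Y <= sup V by apply: ub_le_sup; [case: hV|exists Y].
    have : pr X <= pr Y by apply: probr_le => //; exact: Qm.
    by lra.
  have e1 : 0 < (sup V - pr X) / 2 by lra.
  have [_ [N [QN XN] <-] hN] := sup_adherent e1 hV.
  exists N => _; split => // Y QY XY.
  have : pr Y <= sup V by apply: ub_le_sup; [case: hV|exists Y].
  by lra.
pose X_ k := iter k (fun X => sval (next X)) X0.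
have QX k : Q (X_ k).
  by elim: k => // k /(svalP (next _))[].
have Xnd : nondecreasing_seq X_.
  apply/nondecreasing_seqP => k; apply/subsetPset.
  by have [] := svalP (next (X_ k)) (QX k).
exists (\bigcup_k X_ k); split; first exact: Qcup.
move=> Y QY XY.
have XkY k : X_ k `<=` Y by apply: subset_trans XY; exact: bigcup_sup.
have step k : pr Y - pr (X_ k) <= (pr Y - pr X0) / 2 ^+ k.
  elim: k => [|k IH]; first by rewrite expr0 divr1.
  have [_ _ /(_ Y QY (XkY k)) H] := svalP (next (X_ k)) (QX k).
  apply: (le_trans H); rewrite exprS invfM mulrA mulrAC ler_pM2r//.
have mX : measurable (\bigcup_k X_ k) by apply/Qm/Qcup.
rewrite -subr_le0; apply/ler_addgt0Pl => e e0; rewrite addr0.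
have [k hk] : exists k, (pr Y - pr X0) / 2 ^+ k < e.
  have := half_expn_cvg0 (pr Y - pr X0).
  move=> /cvgrPdist_lt/(_ _ e0)[k _ /(_ k (leqnn k))].
  rewrite /= sub0r normrN => c; exists k.
  by apply: le_lt_trans c; exact: ler_norm.
apply: ltW; apply: le_lt_trans hk; apply: le_trans (step k).
by rewrite lerB//; apply: probr_le => //; [exact: Qm|exact: bigcup_sup].
Qed.


(** * Halving a set conditionally *)

(** A maximal [X] with conditional probability at most half that of [E] must
    reach the bound: otherwise, on some non-null [B] of [C], the deficit exceeds
    [2 ^- k], and a set of conditional probability at most [2 ^- k] taken from
    [(E `\` X) `&` B] could be added to [X]. *)
Lemma conditional_half_pr E : measurable E ->
  exists E', [/\ measurable E', E' `<=` E &
    forall F, C F -> pr (F `&` E') = pr (F `&` E) / 2].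
Proof.
move=> mEE; have i1 := intble_cst P 1.
pose Q X := [/\ measurable X, X `<=` E &
  forall F, C F -> pr (F `&` X) <= pr (F `&` E) / 2].
have [|||X [[mX XE XH] Xmax]] := @greedy_maximal Q.
- exists set0; split => // F CF; rewrite setI0 /probr setint0 divr_ge0//.
  exact: probr_ge0.
- by move=> X [].
- move=> X QX ndX; have mX k : measurable (X k) by case: (QX k).
  split; first exact: bigcup_measurable.
    by apply: bigcup_sub => k _; case: (QX k).
  move=> F CF.
  have mU : measurable (\bigcup_k X k) by exact: bigcup_measurable.
  have h : (fun k => pr (F `&` X k)) @ \oo --> pr (F `&` \bigcup_k X k).
    apply: (setint_approx i1 mU mX _ _ _ (bigcup_gap P mX ndX)) => //.
    + by move=> k; exact: measurableD.
    + by move=> k ?.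

    + by move=> k x [Xk nU]; exfalso; apply: nU; exists k.
    + exact: CA.
  apply: (cvgr_to_le h); apply: nearW => k; by case: (QX k) => _ _; apply.
exists X; split => // F0 CF0; have mF0 := CA CF0.
apply/eqP; rewrite eq_le XH//= leNgt; apply/negP => lt0.
have i2 : intble (fun w => 2^-1 * ((cst 1 : T -> R) \_ E) w - ((cst 1 : T -> R) \_ X) w).
  by apply: intbleB; first apply: intbleZ; exact: intble_restr.
have q2 F : C F -> nu (fun w => 2^-1 * ((cst 1 : T -> R) \_ E) w - ((cst 1 : T -> R) \_ X) w) F =
    pr (F `&` E) / 2 - pr (F `&` X).
  move=> CF; have mF := CA CF.
  rewrite setintB ?setintZ ?setint_restr//; first by rewrite mulrC.
  - exact: intble_restr.
  - by apply: intbleZ; exact: intble_restr.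
  - exact: intble_restr.
have [k hk] : exists k, 2^-1 ^+ k < pr (F0 `&` E) / 2 - pr (F0 `&` X).
  have := half_expn_cvg0 (1 : R); rewrite -subr_gt0 in lt0.
  move=> /cvgrPdist_lt/(_ _ lt0)[k _ /(_ k (leqnn k))].
  rewrite /= sub0r normrN mul1r ger0_norm ?invr_ge0 ?exprn_ge0// => h.
  by exists k; rewrite exprVn.
have [B CB H] := condexp_compare (intble_cst P (2^-1 ^+ k)) i2.
have q1 F : C F -> nu (cst (2^-1 ^+ k)) F = 2^-1 ^+ k * pr F.
  by move=> CF; rewrite -setintZ//; [rewrite /setint; under [RHS]eq_Rintegral do rewrite mulr1|exact: CA].
have mB := CA CB.
pose G := (E `\` X) `&` B.
have mG : measurable G by apply: measurableI => //; exact: measurableD.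
have CFB := CI CF0 CB; have CFB' := CD CF0 CB.
have mFB := CA CFB; have mFB' := CA CFB'.
(* a null [G] would make the deficit on [F0 `&` B] nonpositive *)
have G0 : 0 < pr G.
  rewrite lt_neqAle probr_ge0 andbT; apply/negP => /eqP G0.
  have [_] := H _ CF0; rewrite q2// q1// => h.
  have pF1 : pr (F0 `\` B) <= 1 by exact: probr_le1.
  have e0 : 0 <= 2^-1 ^+ k :> R by rewrite exprn_ge0.
  have s1 := setint_split (measurableI _ _ mF0 mEE) mB i1.
  have s2 := setint_split (measurableI _ _ mF0 mX) mB i1.
  have s3 := setint_split (measurableI _ _ mFB mEE) mX i1.
  have e1 : F0 `&` E `&` B = F0 `&` B `&` E by set_tauto.
  have e2 : F0 `&` E `\` B = (F0 `\` B) `&` E by set_tauto.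
  have e3 : F0 `&` X `&` B = F0 `&` B `&` X by set_tauto.
  have e4 : F0 `&` X `\` B = (F0 `\` B) `&` X by set_tauto.
  have e5 : F0 `&` B `&` E `&` X = F0 `&` B `&` X by set_tauto.
  have g1 : nu (cst 1) (F0 `&` B `&` E `\` X) <= 0.
    rewrite -[leRHS](_ : pr G = 0)//; apply: probr_le => //.
      by apply: measurableD => //; exact: measurableI.
    by rewrite /G; set_tauto.
  have g2 := probr_ge0 P (F0 `&` B `&` X).
  rewrite e1 e2 in s1; rewrite e3 e4 in s2; rewrite e5 in s3.
  move: hk h; rewrite /probr s1 s2 s3 -!/(pr _) => hk h.
  have : 2^-1 ^+ k * pr (F0 `\` B) <= 2^-1 ^+ k by rewrite ler_piMr.
  move: g1 g2 hk h; rewrite /probr; lra.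
have [Z [mZ ZG Z0 HZ]] := nonnull_small k mG G0.
have QZ : Q (X `|` Z).
  split; first exact: measurableU.
    by move: ZG; rewrite /G => ?; set_tauto.
  move=> F CF; have mF := CA CF.
  have [h1 _] := H _ CF; have CFB1 := CI CF CB.
  rewrite q1// q2// in h1.
  have HZF := HZ _ CFB1.
  have s0 : pr (F `&` (X `|` Z)) = pr (F `&` X) + pr (F `&` Z).
    rewrite setIUr /probr setintU//; try exact: measurableI.
    by move: ZG; rewrite /G => ?; set_tauto.
  rewrite s0.
  have e1 : F `&` Z = F `&` B `&` Z by move: ZG; rewrite /G => ?; set_tauto.
  have h2 : pr (F `&` B `&` G) <= pr (F `&` B).
    apply: probr_le; [exact/measurableI/mG/CA|exact: CA|by set_tauto].
  have mFB1 := CA CFB1; have mFB1' := CA (CD CF CB).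
  have h3 := XH _ (CD CF CB).
  have s1 := setint_split (measurableI _ _ mF mEE) mB i1.
  have s2 := setint_split (measurableI _ _ mF mX) mB i1.
  have e2 : F `&` E `&` B = F `&` B `&` E by set_tauto.
  have e3 : F `&` E `\` B = (F `\` B) `&` E by set_tauto.
  have e4 : F `&` X `&` B = F `&` B `&` X by set_tauto.
  have e5 : F `&` X `\` B = (F `\` B) `&` X by set_tauto.
  rewrite e2 e3 in s1; rewrite e4 e5 in s2.
  rewrite e1 /probr s1 s2 -!/(pr _).
  have : pr (F `&` B `&` G) / 2 ^+ k <= pr (F `&` B) * 2^-1 ^+ k.
    by rewrite exprVn ler_pM2r// invr_gt0 exprn_gt0.
  by move: HZF h1 h3; lra.
have := Xmax _ QZ (@subsetUl _ _ _).
have -> : pr (X `|` Z) = pr X + pr Z.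
  by rewrite /probr setintU//; move: ZG; rewrite /G => ?; set_tauto.
by lra.
Qed.

Definition halves g E' E := forall F, C F -> nu g (F `&` E') = nu g (F `&` E) / 2.

(** Membership in [B], a set of [C], may decide which of two solutions to use. *)
Lemma halves_mix g M L E B : measurable M -> measurable L -> measurable E ->
  intble g -> C B -> halves g M E -> halves g L E ->
  halves g ((M `&` B) `|` (L `\` B)) E.
Proof.
move=> mM mL mE' ig CB hM hL F CF; have mF := CA CF; have mB := CA CB.
set X := (X in nu g X); have mX : measurable X.
  apply: measurableI => //; apply: measurableU.
    exact: measurableI.
  exact: measurableD.
rewrite (setint_split mX mB)// (setint_split (measurableI _ _ mF mE') mB)//.
have -> : X `&` B = (F `&` B) `&` M by rewrite /X; set_tauto.
have -> : X `\` B = (F `\` B) `&` L by rewrite /X; set_tauto.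
have -> : F `&` E `&` B = F `&` B `&` E by set_tauto.
have -> : F `&` E `\` B = (F `\` B) `&` E by set_tauto.
by rewrite (hM _ (CI CF CB)) (hL _ (CD CF CB)) mulrDl.
Qed.

(** Halving the two differences gives a solution midway between [L] and [U]:
    it is at half the distance from each. *)
Lemma halves_middle g L U E D1 D2 : measurable L -> measurable U ->
  measurable D1 -> measurable D2 -> intble g ->
  D1 `<=` L `\` U -> D2 `<=` U `\` L ->
  halves g L E -> halves g U E ->
  halves g D1 (L `\` U) -> halves g D2 (U `\` L) ->
  halves g ((L `&` U) `|` D1 `|` D2) E.
Proof.
move=> mL mU mD1 mD2 ig s1 s2 hL hU h1 h2 F CF; have mF := CA CF.
have mFI S : measurable S -> measurable (F `&` S) by exact: measurableI.
have mLU : measurable (L `&` U) by exact: measurableI.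
rewrite !setIUr !setintU//; try (by set_tauto); try (by exact: mFI);
  try (by apply: measurableU; exact: mFI).
rewrite h1// h2//.
have := hL F CF; have := hU F CF.
rewrite (setint_split (mFI _ mL) mU)// (setint_split (mFI _ mU) mL)//.
have -> : F `&` L `&` U = F `&` (L `&` U) by set_tauto.
have -> : F `&` U `&` L = F `&` (L `&` U) by set_tauto.
rewrite -!setIDA.
by lra.
Qed.

Lemma halvesC g E' E : measurable E' -> measurable E -> E' `<=` E ->
  intble g -> halves g E' E -> halves g (E `\` E') E.
Proof.
move=> mE' mE0 sE ig h F CF; have mF := CA CF.
have := setint_split (measurableI _ _ mF mE0) mE' ig.
have -> : F `&` E `&` E' = F `&` E' by set_tauto.
have -> : F `&` E `\` E' = F `&` (E `\` E') by set_tauto.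
by rewrite h//; lra.
Qed.

Section bisection.
Context (m : nat) (g : nat -> T -> R).
Context (ig : forall i, intble (g i)).
Context (IH : forall E, measurable E -> exists E', [/\ measurable E', E' `<=` E,
  halves (cst 1) E' E & forall i, (i < m)%N -> halves (g i) E' E]).
Context (E : set T) (mE0 : measurable E).

Let i1 : intble (cst 1). Proof. exact: intble_cst. Qed.

Let good X := [/\ measurable X, X `<=` E,
  halves (cst 1) X E & forall i, (i < m)%N -> halves (g i) X E].

(** [L] and [U] are solutions for the first [m] densities that enclose the target
    value for the next one, simultaneously over all of [C]. *)
Let bracket (L U : set T) := [/\ good L, good U & forall F, C F ->
  nu (g m) (F `&` L) <= nu (g m) (F `&` E) / 2 <= nu (g m) (F `&` U)].

Let good_mix M L B : C B -> good M -> good L ->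
  good ((M `&` B) `|` (L `\` B)).
Proof.
move=> CB [mM ME M1 Mg] [mL LE L1 Lg]; have mB := CA CB; split.
- by apply: measurableU; [exact: measurableI|exact: measurableD].
- by set_tauto.
- exact: halves_mix.
- by move=> i im; apply: halves_mix => //; [exact: Mg|exact: Lg].
Qed.

Let symdiff (L U : set T) := (L `\` U) `|` (U `\` L).

(** A solution and its complement in [E] have opposite errors; exchange them
    on a set of [C] so that the signs come out right. *)
Let bracket0 : exists L U, bracket L U.
Proof.
have [H [mH HE H1 Hg]] := IH mE0.
have gH : good H by [].
have gH' : good (E `\` H).
  split; [exact: measurableD|by set_tauto|exact: halvesC|].
  by move=> i im; apply: halvesC => //; exact: Hg.
have mH' : measurable (E `\` H) by case: gH'.
have [B CB HB] := condexp_compare (intble_restr mH (ig m))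
                                  (intble_restr mH' (ig m)).
exists ((H `&` B) `|` ((E `\` H) `\` B)), (((E `\` H) `&` B) `|` (H `\` B)).
split; [exact: good_mix|exact: good_mix|].
move=> F CF; have mB := CA CB.
have [] := HB _ CF; rewrite !setint_restr => h1 h2.
have mFB := CA (CI CF CB); have mFB' := CA (CD CF CB).
have mE1 := measurableI _ _ mFB mE0; have mE2 := measurableI _ _ mFB' mE0.
have mFE := measurableI _ _ (CA CF) mE0.
have e0 := setint_split mFE mB (ig m).
have e1 := setint_split mE1 mH (ig m); have e2 := setint_split mE2 mH (ig m).
have s1 : F `&` E `&` B = F `&` B `&` E by set_tauto.
have s2 : F `&` E `\` B = (F `\` B) `&` E by set_tauto.
have s3 : F `&` B `&` E `&` H = F `&` B `&` H by set_tauto.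
have s4 : (F `\` B) `&` E `&` H = (F `\` B) `&` H by set_tauto.
rewrite s1 s2 in e0; rewrite s3 -setIDA in e1; rewrite s4 -setIDA in e2.
have -> : F `&` ((H `&` B) `|` ((E `\` H) `\` B)) =
    (F `&` B `&` H) `|` ((F `\` B) `&` (E `\` H)) by set_tauto.
have -> : F `&` (((E `\` H) `&` B) `|` (H `\` B)) =
    (F `&` B `&` (E `\` H)) `|` ((F `\` B) `&` H) by set_tauto.
have mI S1 S2 : measurable S1 -> measurable S2 -> measurable (S1 `&` S2).
  exact: measurableI.
rewrite !setintU//; try (by set_tauto); try exact: mI.
rewrite e0 e1 e2; apply/andP; split; lra.
Qed.

(** The middle solution replaces [L] or [U] according to the sign of its own
    error, decided on a set of [C]. The intersections grow, the unions shrink,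
    and the symmetric difference loses half of its measure. *)
Let bracket_step L U : bracket L U -> exists L' U', [/\ bracket L' U',
  L `&` U `<=` L' `&` U', L' `|` U' `<=` L `|` U &
  pr (symdiff L' U') <= pr (symdiff L U) / 2].
Proof.
move=> [gL gU gLU]; have [mL LE L1 Lg] := gL; have [mU UE U1 Ug] := gU.
have mLU : measurable (L `\` U) by exact: measurableD.
have mUL : measurable (U `\` L) by exact: measurableD.
have [D1 [mD1 D1s D11 D1g]] := IH mLU.
have [D2 [mD2 D2s D21 D2g]] := IH mUL.
pose M := (L `&` U) `|` D1 `|` D2.
have gM : good M.
  split.
  - by rewrite /M; apply: measurableU => //; apply: measurableU => //; exact: measurableI.
  - by rewrite /M; set_tauto.
  - exact: halves_middle.
  - move=> i im; apply: halves_middle => //;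
      [exact: Lg|exact: Ug|exact: D1g|exact: D2g].
have mM : measurable M by case: gM.
have [B CB HB] := condexp_compare (intble_restr mM (ig m))
  (intbleZ 2^-1 (intble_restr mE0 (ig m))).
have mB := CA CB.
exists ((M `&` B) `|` (L `\` B)), ((U `&` B) `|` (M `\` B)); split.
- split; [exact: good_mix|exact: good_mix|].
  move=> F CF; have mF := CA CF.
  have CFB := CI CF CB; have CFB' := CD CF CB.
  have [] := HB _ CF; rewrite !setint_restr.
  rewrite !setintZ ?setint_restr; try (exact: CA); try (exact: intble_restr).
  have := gLU _ CFB; have := gLU _ CFB'.
  have mI S1 S2 : measurable S1 -> measurable S2 -> measurable (S1 `&` S2).
    exact: measurableI.
  have mFB := CA CFB; have mFB' := CA CFB'.
  have -> : F `&` ((M `&` B) `|` (L `\` B)) =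
    (F `&` B `&` M) `|` ((F `\` B) `&` L) by move: (M) => M'; set_tauto.
  have -> : F `&` ((U `&` B) `|` (M `\` B)) =
    (F `&` B `&` U) `|` ((F `\` B) `&` M) by move: (M) => M'; set_tauto.
  rewrite !setintU//; try (by move: (M) => M'; set_tauto); try exact: mI.
  rewrite (setint_split (mI _ _ mF mE0) mB)//.
  have -> : F `&` E `&` B = F `&` B `&` E by set_tauto.
  have -> : F `&` E `\` B = (F `\` B) `&` E by set_tauto.
  move=> /andP[a1 a2] /andP[a3 a4] a5 a6; apply/andP; split; lra.
- by rewrite /M; clear -D1s D2s; set_tauto.
- by rewrite /M; clear -D1s D2s; set_tauto.
- have mI S1 S2 : measurable S1 -> measurable S2 -> measurable (S1 `&` S2).
    exact: measurableI.
  have mD S1 S2 : measurable S1 -> measurable S2 -> measurable (S1 `\` S2).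
    exact: measurableD.
  have CBc : C (~` B) by rewrite -setTD; exact: CD.
  have mBc := CA CBc.
  have h1 := D11 _ CB; have h2 := D11 _ CBc.
  have h3 := D21 _ CB; have h4 := D21 _ CBc.
  have k1 := setint_split (mI _ _ mBc mLU) mD1 i1.
  have k2 := setint_split (mI _ _ mB mUL) mD2 i1.
  have k3 := setint_split mLU mB i1; have k4 := setint_split mUL mB i1.
  have t1 : ~` B `&` (L `\` U) `&` D1 = ~` B `&` D1 by clear -D1s; set_tauto.
  have t2 : B `&` (U `\` L) `&` D2 = B `&` D2 by clear -D2s; set_tauto.
  have t3 : (L `\` U) `&` B = B `&` (L `\` U) by set_tauto.
  have t4 : (L `\` U) `\` B = ~` B `&` (L `\` U) by set_tauto.
  have t5 : (U `\` L) `&` B = B `&` (U `\` L) by set_tauto.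
  have t6 : (U `\` L) `\` B = ~` B `&` (U `\` L) by set_tauto.
  rewrite t1 in k1; rewrite t2 in k2; rewrite t3 t4 in k3; rewrite t5 t6 in k4.
  have e0 : pr (symdiff L U) = nu (cst 1) (L `\` U) + nu (cst 1) (U `\` L).
    by rewrite -setintU//; set_tauto.
  have -> : symdiff (M `&` B `|` L `\` B) (U `&` B `|` M `\` B) =
    (((~` B `&` (L `\` U)) `\` D1) `|` (B `&` D1)) `|`
    (((B `&` (U `\` L)) `\` D2) `|` (~` B `&` D2)).
    by rewrite /symdiff /M; clear -D1s D2s; set_tauto.
  rewrite e0 /probr !setintU//; try (by clear -D1s D2s; set_tauto);
    try (by auto); try (by apply: measurableU; auto).
  by lra.
Qed.

(** Both ends of the brackets converge to the union of their intersections, so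
    the enclosure becomes an equality there. *)
Lemma bisection_half : exists E', [/\ measurable E', E' `<=` E,
  halves (cst 1) E' E, (forall i, (i < m)%N -> halves (g i) E' E) &
  halves (g m) E' E].
Proof.
have [L0 [U0 b0]] := bracket0.
pose r (x y : set T * set T) := bracket x.1 x.2 -> [/\ bracket y.1 y.2,
  x.1 `&` x.2 `<=` y.1 `&` y.2, y.1 `|` y.2 `<=` x.1 `|` x.2 &
  pr (symdiff y.1 y.2) <= pr (symdiff x.1 x.2) / 2].
have next x : {y | r x y}.
  apply: cid; have [b|nb] := pselect (bracket x.1 x.2); last by exists x.
  by have [L' [U' H]] := bracket_step b; exists (L', U').
pose s k := iter k (fun x => sval (next x)) (L0, U0).
have bs k : bracket (s k).1 (s k).2.
  by elim: k => // k /(svalP (next _))[].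
have step k := svalP (next (s k)) (bs k).
pose I k := (s k).1 `&` (s k).2; pose W k := (s k).1 `|` (s k).2.
have ndI i j : (i <= j)%N -> I i `<=` I j.
  elim: j => [|j IHj]; first by rewrite leqn0 => /eqP ->.
  rewrite leq_eqVlt => /orP[/eqP -> //|]; rewrite ltnS => /IHj ij.
  by apply: (subset_trans ij); have [] := step j.
have niW i j : (i <= j)%N -> W j `<=` W i.
  elim: j => [|j IHj]; first by rewrite leqn0 => /eqP ->.
  rewrite leq_eqVlt => /orP[/eqP -> //|]; rewrite ltnS => /IHj ij.
  by apply: (subset_trans _ ij); have [] := step j.
have mL k : measurable (s k).1 by have [[]] := bs k.
have mU k : measurable (s k).2 by have [_ []] := bs k.
pose D k := symdiff (s k).1 (s k).2.
have mD k : measurable (D k) by apply: measurableU; exact: measurableD.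
have Dk k : pr (D k) <= pr (D 0%N) / 2 ^+ k.
  elim: k => [|k IHk]; first by rewrite expr0 divr1.
  have [_ _ _ h] := step k; apply: (le_trans h).
  by rewrite exprS invfM mulrA mulrAC ler_pM2r.
have D0 : (fun k => pr (D k)) @ \oo --> 0.
  apply: (squeeze_cvgr _ (cvg_cst 0) (half_expn_cvg0 (pr (D 0%N)))).
  by apply: nearW => k; rewrite Dk andbT; exact: probr_ge0.
pose E' := \bigcup_k I k.
have mE' : measurable E'.
  by apply: bigcup_measurable => k _; exact: measurableI.
have E'L k : E' `\` (s k).1 `<=` D k /\ E' `\` (s k).2 `<=` D k.
  suff h x : E' x -> I k x \/ W k x /\ D k x.
    by split => x [/h]; rewrite /I /W /D /symdiff /=; tauto.
  move=> [j _ Ij]; have [jk|kj] := leqP j k; first by left; exact: ndI Ij.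
  have : W k x by apply: (niW k j (ltnW kj)); case: Ij => ? ?; left.
  have [Ik _|nIk Wk] := pselect (I k x); [by left|right; split => //].
  move: nIk Wk; rewrite /I /W /D /symdiff /setI /setU /setD /=.
  by have [?|?] := pselect ((s k).1 x); have [?|?] := pselect ((s k).2 x); tauto.
have LE' k : (s k).1 `\` E' `<=` D k /\ (s k).2 `\` E' `<=` D k.
  have h x : I k x -> E' x by exists k.
  split => x [/= Sk nE]; have nI : ~ I k x by [move=> /h].
    by left; split => // ?; apply: nI.
  by right; split => // ?; apply: nI.
have cL g' F : intble g' -> C F ->
    (fun k => nu g' (F `&` (s k).1)) @ \oo --> nu g' (F `&` E').
  move=> ig' CF; apply: (setint_approx ig' mE' mL mD _ _ D0) => //.
  - by move=> k; case: (E'L k).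
  - by move=> k; case: (LE' k).
  - exact: CA.
have cU g' F : intble g' -> C F ->
    (fun k => nu g' (F `&` (s k).2)) @ \oo --> nu g' (F `&` E').
  move=> ig' CF; apply: (setint_approx ig' mE' mU mD _ _ D0) => //.
  - by move=> k; case: (E'L k).
  - by move=> k; case: (LE' k).
  - exact: CA.
have lim g' : intble g' -> (forall k, halves g' (s k).1 E) -> halves g' E' E.
  move=> ig' h F CF; apply/eqP; rewrite eq_le; apply/andP; split.
    by apply: (cvgr_to_le (cL g' F ig' CF)); apply: nearW => k; rewrite h.
  by apply: (cvgr_to_ge (cL g' F ig' CF)); apply: nearW => k; rewrite h.
exists E'; split => //.
- apply: bigcup_sub => k _; have [[_ LE _ _] _ _] := bs k.
  by apply: subset_trans LE; exact: subIsetl.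
- by apply: lim => // k; have [[]] := bs k.
- by move=> i im; apply: lim => // k; have [[_ _ _ h] _ _] := bs k; exact: h.
- move=> F CF; apply/eqP; rewrite eq_le; apply/andP; split.
    apply: (cvgr_to_le (cL _ F (ig m) CF)); apply: nearW => k.
    by have [_ _ /(_ F CF)/andP[]] := bs k.
  apply: (cvgr_to_ge (cU _ F (ig m) CF)); apply: nearW => k.
  by have [_ _ /(_ F CF)/andP[]] := bs k.
Qed.

End bisection.

(** Lyapunov's theorem for the weight one half, by induction on the number of
    densities. The constant density is always included, since the measure of the
    differences must be halved as well for the bisection to converge. *)
Lemma conditional_half m (g : nat -> T -> R) : (forall i, intble (g i)) ->
  forall E, measurable E -> exists E', [/\ measurable E', E' `<=` E,
    halves (cst 1) E' E & forall i, (i < m)%N -> halves (g i) E' E].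
Proof.
move=> ig; elim: m => [|m IH] E mE0.
  by have [E' [mE' EE' h]] := conditional_half_pr mE0; exists E'.
have [E' [mE' EE' E'1 E'g E'm]] := bisection_half ig IH mE0.
exists E'; split => // i; rewrite ltnS leq_eqVlt => /orP[/eqP -> //|].
exact: E'g.
Qed.

(** * Replacing a weight by a set *)

Section rounding.
Context (n : nat) (g : nat -> T -> R) (lam : T -> R).
Context (ig : forall i, intble (g i)).
Context (mlam : measurable_fun setT lam).
Context (lam01 : forall w, 0 <= lam w <= 1).

Let weighted (l : T -> R) i w := l w * g i w.

Let intble_weighted (l : T -> R) i : measurable_fun setT l -> (forall w, 0 <= l w <= 1) ->
  intble (weighted l i).
Proof.
move=> ml l01; apply: (intble_le _ _ (intble_norm (ig i))).
  by apply: measurable_funM => //; exact: (intble_meas (ig i)).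
move=> w; have /andP[l0 l1] := l01 w.
by rewrite normrM (ger0_norm l0) ler_piMl.
Qed.

(** [X] is the part of the final set decided so far, [Y] the part of the space
    still undecided, which carries the remaining weight [l]. *)
Let state (s : set T * set T * (T -> R)) :=
  let: (X, Y, l) := s in
  [/\ [/\ measurable X, measurable Y, measurable_fun setT l &
          forall w, 0 <= l w <= 1],
      [/\ X `&` Y = set0, (forall w, l w != 0 -> Y w),
          (forall w, 0 < l w -> 0 < lam w), (forall w, X w -> 0 < lam w) &
          (forall w, lam w = 1 -> X w \/ l w = 1)] &
      forall i F, (i < n)%N -> C F ->
        nu (g i) (F `&` X) + nu (weighted l i) F = nu (weighted lam i) F].

(** Let [H] halve [S], and let [D] be the event that the leading binary digit of
    [l] is one. The half of [1_D] owed to that digit is paid by putting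
    [H `&` D] into [X]; the rest of [l], which is at most one half, is doubled and moved
    onto [S `\` H]. All conditional expectations are preserved exactly. *)
Let state_step X S (l : T -> R) : state (X, S, l) -> exists X' S' l',
  [/\ state (X', S', l'), X `<=` X', X' `|` S' `<=` X `|` S &
      pr S' <= pr S / 2].
Proof.
move=> [[mX mS ml l01] [XS lS l0 X0 l1] Hnu].
have {}XS : X `&` S `<=` set0 by rewrite XS.
pose D := l @^-1` `[2^-1, +oo[.
have mD : measurable D by rewrite -[D]setTI; exact: ml.
have Dl w : D w <-> 2^-1 <= l w by rewrite /D/= in_itv/= andbT.
have DS w : D w -> S w.
  by move=> /Dl h; apply: lS; apply/negP => /eqP l0'; rewrite l0' in h; lra.
have iD i : intble (g i \_ D) by exact: intble_restr.
pose h j := if (j < n)%N then weighted l j else g (j - n)%N \_ D.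
have ih j : intble (h j) by rewrite /h; case: ifP => // _; exact: intble_weighted.
have [H [mH HS H1 Hh]] := conditional_half (n + n)%N ih mS.
have Hl i : (i < n)%N -> halves (weighted l i) H S.
  move=> i_n; have := Hh i; rewrite /h i_n; apply.
  by rewrite ltn_addr.
have HD i : (i < n)%N -> halves (g i \_ D) H S.
  move=> i_n; have ni : (n + i < n)%N = false by rewrite ltnNge leq_addr.
  have := Hh (n + i)%N; rewrite /h ni addKn; apply.
  by rewrite ltn_add2l.
have mSH : measurable (S `\` H) by exact: measurableD.
have mHD : measurable (H `&` D) by exact: measurableI.
pose l' := (fun w => 2 * l w - \1_D w) \_ (S `\` H).
exists (X `|` (H `&` D)), (S `\` H), l'.
have ml' : measurable_fun setT l'.
  apply/(measurable_restrictT _ mSH); apply: measurable_funTS.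
  by apply: measurable_funB; [exact: measurable_funM|exact: measurable_indic].
have l'E w : l' w = if w \in S `\` H then 2 * l w - (w \in D)%:R else 0.
  by rewrite /l' patchE; case: ifP => // _; rewrite indicE.
split.
- split.
  + split => //; first exact: measurableU.
    move=> w; rewrite l'E; case: ifP => _; last by rewrite lexx ler01.
    have /andP[? ?] := l01 w; case: (boolP (w \in D)) => wD.
      by move: wD; rewrite inE => /Dl; rewrite /= => ?; apply/andP; split; lra.
    have : ~ 2^-1 <= l w by move=> /Dl/mem_set; exact/negP.
    by move=> /negP; rewrite -ltNge /= => ?; apply/andP; split; lra.
  + split.
    * by clear -HS XS; set_tauto.
    * by move=> w; rewrite l'E; case: ifP => [/set_mem//|]; rewrite eqxx.
    * move=> w; rewrite l'E; case: ifP => _ h0; last by rewrite ltxx in h0.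
      apply: l0.
      have : 0 <= (w \in D)%:R :> R by rewrite ler0n.
      by move: h0; move: ((w \in D)%:R : R) => b; lra.
    * move=> w [Xw|[_ Dw]]; first exact: X0.
      by have hw := (Dl w).1 Dw; apply: l0; lra.
    * move=> w lw; have [?|lw1] := l1 w lw; first by left; left.
      have wD : D w by apply/Dl; rewrite lw1; lra.
      have [wH|wH] := pselect (H w); first by left; right.
      right; rewrite l'E (mem_set wD) mem_set/=; last by split => //; exact: DS.
      by rewrite lw1; lra.
  + move=> i F i_n CF; have mF := CA CF; rewrite -(Hnu i F i_n CF).
    have iwl : intble (weighted l i) by exact: intble_weighted.
    have -> : nu (g i) (F `&` (X `|` (H `&` D))) =
        nu (g i) (F `&` X) + nu (g i \_ D) (F `&` H).
      rewrite setint_restr -setIA setIUr setintU//; try exact: measurableI.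
      by clear -HS XS; set_tauto.
    rewrite HD// -addrA; congr (_ + _).
    have mFSH : measurable (F `&` (S `\` H)) by exact: measurableI.
    have -> : nu (weighted l' i) F =
        2 * nu (weighted l i) (F `&` (S `\` H)) -
        nu (g i \_ D) (F `&` (S `\` H)).
      rewrite -setintZ// -setintB//; last exact: intbleZ.
      rewrite -setint_restr; congr (setint P _ F).
      apply/funext => w; rewrite /weighted l'E !patchE.
      case: ifP => _; last by rewrite mul0r.
      by case: ifP => _ /=; [ring|rewrite -[point]/(0 : R); ring].
    rewrite (halvesC mH mS HS iwl (Hl i i_n))//.
    rewrite (halvesC mH mS HS (iD i) (HD i i_n))//.
    have -> : nu (weighted l i) (F `&` S) = nu (weighted l i) F.
      rewrite -setint_restr; congr (nu _ F); apply/funext => w; rewrite patchE.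
      case: ifPn => // /negP wS; rewrite /weighted; apply/eqP.
      rewrite eq_sym mulf_eq0; apply/orP; left; apply/negPn/negP => lw.
      by apply: wS; rewrite inE; exact: lS.
    by lra.
- by clear; set_tauto.
- by clear -HS; set_tauto.
- have := halvesC mH mS HS (intble_cst P 1) H1 CT.
  by rewrite !setTI => h1; rewrite /probr h1.
Qed.

(** The undecided part halves at every step, so its contribution vanishes in the
    limit. On [lam = 1] a point leaves the undecided part only by entering [X];
    adding these points to the limit set changes it by a null set and makes the
    inclusions between [E] and the level sets of [lam] hold everywhere. *)
Lemma conditional_lyapunov : exists E, [/\ measurable E,
  (forall w, E w -> 0 < lam w), (forall w, lam w = 1 -> E w) &
  forall i F, (i < n)%N -> C F ->
    nu (g i) (F `&` E) = nu (fun w => lam w * g i w) F].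
Proof.
have s0 : state (set0, setT, lam).
  split; [split => //| split => //|]; first by rewrite set0I.
  - by move=> w; right.
  - by move=> i F _ _; rewrite setI0 setint0 add0r.
have next s : {s' | state s -> [/\ state s', s.1.1 `<=` s'.1.1,
    s'.1.1 `|` s'.1.2 `<=` s.1.1 `|` s.1.2 & pr s'.1.2 <= pr s.1.2 / 2]}.
  apply: cid; have [b|nb] := pselect (state s); last by exists s.
  case: s b => [[X S] l] /state_step[X' [S' [l' H]]].
  by exists (X', S', l').
pose s k := iter k (fun x => sval (next x)) (set0, setT, lam).
have ss k : state (s k).
  by elim: k => // k /(svalP (next _))[].
have step k := svalP (next (s k)) (ss k).
pose X k := (s k).1.1; pose S k := (s k).1.2; pose l k := (s k).2.
have sE k : state (X k, S k, l k).
  by have := ss k; rewrite /X /S /l; case: (s k) => [[]].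
have mX k : measurable (X k) by have [[]] := sE k.
have mS k : measurable (S k) by have [[]] := sE k.
have XXS i j : X j `<=` X i `|` S i.
  have [ij|/ltnW ji] := leqP i j.
    suff h : X j `|` S j `<=` X i `|` S i.
      by apply: subset_trans h; exact: subsetUl.
    elim: j ij => [|j IHj]; first by rewrite leqn0 => /eqP ->.
    rewrite leq_eqVlt => /orP[/eqP -> //|]; rewrite ltnS => /IHj ij.
    by apply: (subset_trans _ ij); have [] := step j.
  suff h : X j `<=` X i by apply: (subset_trans h); exact: subsetUl.
  elim: i ji => [|i IHi]; first by rewrite leqn0 => /eqP ->.
  rewrite leq_eqVlt => /orP[/eqP -> //|]; rewrite ltnS => /IHi ij.
  by apply: (subset_trans ij); have [] := step i.
have Sk k : pr (S k) <= pr (S 0%N) / 2 ^+ k.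
  elim: k => [|k IHk]; first by rewrite expr0 divr1.
  have [_ _ _ h] := step k; apply: (le_trans h).
  by rewrite exprS invfM mulrA mulrAC ler_pM2r.
have S0 : (fun k => pr (S k)) @ \oo --> 0.
  apply: (squeeze_cvgr _ (cvg_cst 0) (half_expn_cvg0 (pr (S 0%N)))).
  by apply: nearW => k; rewrite Sk andbT; exact: probr_ge0.
pose lam1 := lam @^-1` [set 1].
have mlam1 : measurable lam1.
  by rewrite -[lam1]setTI; apply: mlam => //; exact: measurable_set1.
pose E := (\bigcup_k X k) `|` lam1.
have mE1 : measurable E.
  by apply: measurableU => //; exact: bigcup_measurable.
have lk0 k w : l k w != 0 -> S k w by have [_ [_ h _ _ _] _] := sE k; exact: h.
have ES k : E `\` X k `<=` S k.
  move=> w [[[j _ Xj]|lw] nX]; first by have [//|] := XXS k j w Xj.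
  have [_ [_ _ _ _ h] _] := sE k; have [//|lkw] := h w lw.
  by apply: lk0; rewrite lkw oner_neq0.
have XE k : X k `\` E `<=` S k by move=> w [Xk []]; left; exists k.
exists E; split => //.
- move=> w [[k _]|->]; last exact: ltr01.
  by have [_ [_ _ _ h _] _] := sE k; exact: h.
- by move=> w lw; right.
move=> i F i_n CF; have mF := CA CF.
have c1 := setint_approx (ig i) mE1 mX mS ES XE S0 mF.
have ign := intble_norm (ig i).
have c2 : (fun k => nu (weighted (l k) i) F) @ \oo --> 0.
  have := setint_approx ign measurable0 mS mS _ _ S0 mF.
  rewrite setI0 setint0 => /(_ _ _)/cvgr_dist_le c.
  apply/cvgrPdist_le => e e0.
  have [] := (c _ _ e e0); [by move=> k w []|by move=> k w []|].
  move=> N _ cN; exists N => // k /cN; rewrite /= !sub0r !normrN; apply: le_trans.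
  have [[_ _ mlk lk01] _ _] := sE k.
  have iw : intble (weighted (l k) i) by exact: intble_weighted.
  apply: (le_trans (le_setint_norm mF iw)); apply: le_trans (ler_norm _).
  rewrite -setint_restr; apply: le_setint => //; first exact: intble_norm.
    exact: intble_restr.
  move=> w _; rewrite patchE; case: ifPn => [_|/negP wS].
    have /andP[l0 l1] := lk01 w.
    by rewrite /weighted normrM (ger0_norm l0) ler_piMl.
  rewrite /weighted (_ : l k w = 0) ?mul0r ?normr0//.
  by apply/eqP/negPn/negP => /lk0 Sw; apply: wS; rewrite inE.
have c3 : (fun k => nu (g i) (F `&` X k) + nu (weighted (l k) i) F) @ \oo -->
    nu (g i) (F `&` E) by rewrite -[X in _ --> X]addr0; exact: cvgD.
apply/eqP; rewrite eq_le; apply/andP; split.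
  apply: (cvgr_to_le c3); apply: nearW => k.
  by have [_ _ /(_ i F i_n CF) <-] := sE k.
apply: (cvgr_to_ge c3); apply: nearW => k.
by have [_ _ /(_ i F i_n CF) <-] := sE k.
Qed.

End rounding.

End conditional_halving.

(** * Compact metric spaces and Caratheodory functions *)

Section compact_metric.
Context (R : realType) (A : pmetricType R).
Context (cA : compact [set: A]).

Lemma compact_countable_base : exists B : nat -> set A,
  (forall j, open (B j)) /\
  (forall x (O : set A), nbhs x O -> exists2 j, B j x & B j `<=` O).
Proof.
have [BB cBB [oB bB]] := compact_second_countable cA.
have BBne x O : nbhs x O -> exists2 U, BB U /\ U x & U `<=` O.
  by move=> /(bB x)[U UB UO]; exists U.
have [U0 [BU0 _] _] := BBne point setT filterT.
have /pfcard_geP[BB0|[e]] := cBB; first by rewrite BB0 in BU0.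
exists e; split => [j|x O /BBne[U [BU Ux] UO]].
  by apply: oB; exact: funS.
by have [j _ ej] := surj (f := e) BU; exists j; rewrite ej.
Qed.

Lemma nested_closure_point (X : nat -> set A) :
  (forall j, X j !=set0) -> (forall i j, (i <= j)%N -> X j `<=` X i) ->
  exists p, forall j, closure (X j) p.
Proof.
move=> X0 Xni; pose a j := sval (cid (X0 j)).
have aX j : X j (a j) := svalP (cid (X0 j)).
have [p [_ clp]] := cA (F := a @ \oo) _ filterT.
exists p => j U Up.
have : (a @ \oo) (X j).
  by exists j => // k /= jk; exact: Xni jk _ (aX k).
by move=> /clp/(_ Up).
Qed.

(** By continuity, [c < v w a] holds iff on some basic neighbourhood of [a] the
    function [v w] exceeds [c] by some [1 / (k + 1)], and it suffices to test
    this at countably many points, one from each basic open set. *)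
Lemma caratheodory_measurable d (T : measurableType d) (v : T -> A -> R) :
  (forall a, measurable_fun setT (v ^~ a)) -> (forall w, continuous (v w)) ->
  measurable_fun setT (fun z : T * borel A => v z.1 z.2).
Proof.
move=> mv cv; have [B [oB bB]] := compact_countable_base.
pose q l : A := xget point (B l).
pose e k : R := k.+1%:R^-1.
apply: (measurability _ (RGenOInfty.measurableE R)) => _ [_ [c ->] <-].
rewrite setTI preimage_itvoy.
pose W j k := \bigcap_(l in [set l | B j (q l)]) [set w | c + e k <= v w (q l)].
have mW j k : measurable (W j k).
  apply: bigcap_measurableType => // l _.
  have := mv (q l) measurableT _ (measurable_itv `[c + e k, +oo[).
  by rewrite setTI preimage_itvcy.
rewrite (_ : [set _ | _] = \bigcup_j \bigcup_k (W j k `*` (B j : set (borel A)))).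
  apply: bigcupT_measurable => j; apply: bigcupT_measurable => k.
  by apply: measurableX => //; exact: sub_sigma_algebra.
apply/seteqP; split => -[w a] /=.
  move=> cva; have [k hk] : exists k, c + e k < v w a.
    by have [k hk] := ltr_add_invr cva; exists k.
  have : nbhs a [set a' | c + e k < v w a'].
    exact: (cv w a _ (open_gt hk)).
  move=> /bB[j Ba BO]; exists j => //; exists k => //; split => //= l /BO /=.
  exact: ltW.
move=> [j _ [k _ [/= Ww Ba]]].
suff : c + e k <= v w a by apply: lt_le_trans; rewrite ltrDl invr_gt0 ltr0n.
rewrite leNgt; apply/negP => hva.
have : nbhs a (B j `&` [set a' | v w a' < c + e k]).
  apply: filterI; first exact: open_nbhs_nbhs.
  exact: (cv w a _ (open_lt hva)).
move=> /bB[l Bla BO].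
have Bql : B l (q l) := xgetPex point (ex_intro _ a Bla).
have [Bjq /=] := BO _ Bql; rewrite ltNge => /negP; apply; exact: Ww.
Qed.

End compact_metric.

Lemma setint_dominated d (T : measurableType d) (R : realType)
    (P : probability T R) (u : nat -> T -> R) (g h : T -> R) :
  (forall k, measurable_fun setT (u k)) -> intble P h ->
  (forall k w, `|u k w| <= h w) -> (forall w, u ^~ w @ \oo --> g w) ->
  intble P g /\ forall F, measurable F -> (fun k => setint P (u k) F) @ \oo --> setint P g F.
Proof.
move=> mu ih uh ug.
have mg : measurable_fun setT g.
  by apply: (measurable_fun_cvg (h := u)) => // w _; exact: ug.
have ig : intble P g.
  apply: (intble_le mg _ ih) => w.
  have c : (fun k => `|u k w|) @ \oo --> `|g w| by apply: cvg_norm; exact: ug.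
  by apply: (cvgr_to_le c); apply: nearW => k.
split => // F mF.
have [] := @dominated_convergence _ _ _ P F mF (fun k => EFin \o u k)
  (EFin \o g) (EFin \o h).
- by move=> k; apply/measurable_EFinP; exact: measurable_funTS.
- by apply/measurable_EFinP; exact: measurable_funTS.
- by apply: aeW => w _; apply: cvg_EFin; [exact: nearW|exact: ug].
- exact: intbleS.
- by apply: aeW => w k _; rewrite /= lee_fin.
move=> _ _ /= c.
have fn : (\int[P]_(w in F) (g w)%:E)%E \is a fin_num.
  by apply: integrable_fin_num => //; exact: intbleS.
by rewrite /setint /Rintegral; apply: fine_cvg; rewrite fineK.
Qed.

(** * Averages over the fibres of a kernel *)

Section kernel_average.
Context d (T : measurableType d) (R : realType) (A : ptopologicalType).
Context (delta : young T R A).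
Implicit Types D : set (T * borel A).

Definition section D w : set (borel A) := [set a | D (w, a)].

Lemma section_xsection D w : section D w = xsection D w.
Proof. by apply/funext => a; rewrite /xsection/= inE. Qed.

Lemma measurable_section D w : measurable D -> measurable (section D w).
Proof. by rewrite section_xsection; exact: measurable_xsection. Qed.

Definition mass D w : R := fine (delta w (section D w)).

Lemma delta_fin D w : measurable D -> delta w (section D w) \is a fin_num.
Proof.
move=> mD; rewrite ge0_fin_numE//.
apply: (@le_lt_trans _ _ (delta w setT)).
  by apply: le_measure; rewrite ?inE//; exact: measurable_section.
by rewrite prob_kernel ltry.
Qed.

Lemma massE D w : measurable D -> (mass D w)%:E = delta w (section D w).
Proof. by move=> mD; rewrite /mass fineK//; exact: delta_fin. Qed.

Lemma mass_ge0 D w : 0 <= mass D w.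
Proof. exact: fine_ge0. Qed.

Lemma massT w : mass setT w = 1.
Proof. by rewrite /mass (_ : section setT w = setT)// prob_kernel. Qed.

Lemma measurable_mass D : measurable D -> measurable_fun setT (mass D).
Proof.
move=> mD; have h := measurable_fun_xsection_finite_kernel delta (mem_set mD).
 apply: measurableT_comp => //.
by under eq_fun do rewrite section_xsection.
Qed.

(** For nonnegative reals the inverse is the power [-1], a measurable
    function; both are zero at zero. *)
Lemma measurable_massV D : measurable D ->
  measurable_fun setT (fun w => (mass D w)^-1).
Proof.
move=> mD.
have -> : (fun w => (mass D w)^-1) = (@powR R ^~ (-1)) \o mass D.
  by apply/funext => w /=; rewrite powR_inv1// mass_ge0.
exact: measurableT_comp (measurable_mass mD).
Qed.

Lemma mass_split D U w : measurable D -> measurable U ->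
  mass D w = mass (D `&` (snd @^-1` U)) w + mass (D `\` (snd @^-1` U)) w.
Proof.
move=> mD mU.
have mU' : measurable (snd @^-1` U : set (T * borel A)).
  by rewrite -[X in measurable X]setTI; exact: measurable_snd.
have m1 := measurableI _ _ mD mU'; have m2 := measurableD mD mU'.
apply: EFin_inj; rewrite EFinD !massE// -measureU//.
- by congr (delta w _); rewrite /section; apply/seteqP; split => a /=;
    have [] := pselect (U a); tauto.
- exact: measurable_section.
- exact: measurable_section.
- by apply/seteqP; split => a //=; rewrite /section/=; tauto.
Qed.

Context (v : T -> A -> R) (h : T -> R).
Context (mv : measurable_fun setT (fun z : T * borel A => v z.1 z.2)).
Context (vh : forall w a, `|v w a| <= h w).

Let mvw w : measurable_fun setT (v w : borel A -> R).
Proof. exact: (measurableT_comp mv (pair1_measurable w)). Qed.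

Lemma integrable_kernel w (B : set (borel A)) : measurable B ->
  (delta w).-integrable B (EFin \o v w).
Proof.
move=> mB; apply: measurable_bounded_integrable => //.
- apply: (@le_lt_trans _ _ (delta w setT)).
    by apply: le_measure; rewrite ?inE.
  by rewrite prob_kernel ltry.
- exact: measurable_funTS.
- exists (h w); split; first exact: num_real.
  by move=> x hx a _ /=; apply: (le_trans (vh w a)); exact: ltW.
Qed.

Definition moment D w : R := \int[delta w]_(a in section D w) v w a.

Lemma measurable_moment D : measurable D -> measurable_fun setT (moment D).
Proof.
move=> mD; pose vD : T * borel A -> R := (fun z => v z.1 z.2) \_ D.
have mvD : measurable_fun setT vD by apply/(measurable_restrictT _ mD); exact: measurable_funTS.
have mE : measurable_fun setT (EFin \o vD) by exact/measurable_EFinP.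
have -> : moment D = fine \o (fun w =>
    \int[delta w]_a (EFin \o vD)^\+ (w, a) -
    \int[delta w]_a (EFin \o vD)^\- (w, a))%E.
  apply/funext => w; rewrite /moment Rintegral_mkcond /Rintegral /=; congr fine.
  have vE a : (v w \_ (section D w)) a = vD (w, a).
    rewrite /vD !patchE.
    suff -> : (a \in section D w) = ((w, a) \in D) by [].
    by apply/idP/idP; rewrite !inE.
  rewrite integralE; congr (_ - _)%E; apply: eq_integral => a _.
    by rewrite !funeposE /= vE.
  by rewrite !funenegE /= vE.
apply: measurableT_comp => //; apply: emeasurable_funB.
- apply: (measurable_fun_integral_finite_kernel _ delta) => //.
  exact: measurable_funepos.
- apply: (measurable_fun_integral_finite_kernel _ delta) => //.
  exact: measurable_funeneg.
Qed.

Lemma moment_split D U w : measurable D -> measurable U ->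
  moment D w = moment (D `&` (snd @^-1` U)) w + moment (D `\` (snd @^-1` U)) w.
Proof.
move=> mD mU.
have mU' : measurable (snd @^-1` U : set (T * borel A)).
  by rewrite -[X in measurable X]setTI; exact: measurable_snd.
have m1 := measurableI _ _ mD mU'; have m2 := measurableD mD mU'.
have sE : section D w = section (D `&` (snd @^-1` U)) w `|` section (D `\` (snd @^-1` U)) w.
  by rewrite /section; apply/seteqP; split => a /=;
    have [] := pselect (U a); tauto.
rewrite /moment -Rintegral_setU -?sE//.
- exact: measurable_section.
- exact: measurable_section.
- by apply: integrable_kernel; exact: measurable_section.
- by apply/disj_setPS => a /=; rewrite /section/=; tauto.
Qed.

Lemma le_moment D w (r : R) : measurable D ->
  (forall a, section D w a -> v w a <= r) -> moment D w <= r * mass D w.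
Proof.
move=> mD vr; rewrite /mass -Rintegral_cst; last exact: measurable_section.
have ms := measurable_section w mD.
apply: le_Rintegral => //; first exact: integrable_kernel.
apply: measurable_bounded_integrable => //.
- by rewrite -massE// ltry.
- by exists `|r|; split; [exact: num_real|move=> x rx a _ /=; exact: ltW].
Qed.

Lemma ge_moment D w (r : R) : measurable D ->
  (forall a, section D w a -> r <= v w a) -> r * mass D w <= moment D w.
Proof.
move=> mD vr; rewrite /mass -Rintegral_cst; last exact: measurable_section.
have ms := measurable_section w mD.
apply: le_Rintegral => //; last exact: integrable_kernel.
apply: measurable_bounded_integrable => //.
- by rewrite -massE// ltry.
- by exists `|r|; split; [exact: num_real|move=> x rx a _ /=; exact: ltW].
Qed.

Lemma moment_null D w : measurable D -> mass D w = 0 -> moment D w = 0.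
Proof.
move=> mD D0; apply/eqP; rewrite eq_le; apply/andP; split.
  rewrite -[leRHS](_ : h w * mass D w = 0); last by rewrite D0 mulr0.
  by apply: le_moment => // a _; apply: le_trans (vh w a); exact: ler_norm.
rewrite -[leLHS](_ : - h w * mass D w = 0); last by rewrite D0 mulr0.
by apply: ge_moment => // a _; have := vh w a; rewrite ler_norml => /andP[].
Qed.

(** The integral of [v w] against [delta w] conditioned on the fibre of [D]. The
    random set [D] thus represents the Young measure of the conditioned
    probabilities, without building a new kernel. *)
Definition average D w : R := moment D w / mass D w.

Lemma averageT w : average setT w = \int[delta w]_a v w a.
Proof. by rewrite /average massT divr1. Qed.

Lemma measurable_average D : measurable D -> measurable_fun setT (average D).
Proof.
move=> mD; apply: measurable_funM; first exact: measurable_moment.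
exact: measurable_massV.
Qed.

Lemma average_le D w (r : R) : measurable D -> 0 < mass D w ->
  (forall a, section D w a -> v w a <= r) -> average D w <= r.
Proof. by move=> mD m0 H; rewrite ler_pdivrMr//; exact: le_moment. Qed.

Lemma average_ge D w (r : R) : measurable D -> 0 < mass D w ->
  (forall a, section D w a -> r <= v w a) -> r <= average D w.
Proof. by move=> mD m0 H; rewrite ler_pdivlMr//; exact: ge_moment. Qed.

Lemma norm_average D w : measurable D -> `|average D w| <= h w.
Proof.
move=> mD; have [m0|m0] := ltP 0 (mass D w); last first.
  have m0' : mass D w = 0 by apply/eqP; rewrite eq_le m0 mass_ge0.
  by rewrite /average m0' invr0 mulr0 normr0 (le_trans _ (vh w point)).
rewrite ler_norml; apply/andP; split.
  by apply: average_ge => // a _; have := vh w a; rewrite ler_norml => /andP[].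
by apply: average_le => // a _; apply: le_trans (vh w a); exact: ler_norm.
Qed.

(** The law of total expectation for the partition of the fibre by [U]. A part of
    zero mass has zero moment, so the junk value of its average is harmless. *)
Lemma average_split D U w : measurable D -> measurable U -> 0 < mass D w ->
  let D1 := D `&` (snd @^-1` U) in let D2 := D `\` (snd @^-1` U) in
  average D w =
  average D2 w + mass D1 w / mass D w * (average D1 w - average D2 w).
Proof.
move=> mD mU m0 D1 D2.
have mU' : measurable (snd @^-1` U : set (T * borel A)).
  by rewrite -[X in measurable X]setTI; exact: measurable_snd.
have m1 : measurable D1 by exact: measurableI.
have m2 : measurable D2 by exact: measurableD.
rewrite /average; have := mass_split w mD mU; rewrite -/D1 -/D2 => mE.
have := moment_split w mD mU; rewrite -/D1 -/D2 => ->.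
have [d1|d1] := eqVneq (mass D1 w) 0; have [d2|d2] := eqVneq (mass D2 w) 0.
- by rewrite mE d1 d2 addr0 ltxx in m0.
- by rewrite (moment_null m1 d1) mE d1 !(add0r, mul0r) addr0.
- by rewrite (moment_null m2 d2) mE d2 !addr0 !mul0r add0r subr0 divff// mul1r.
- by rewrite mE in m0 *; field; rewrite d1 d2 (gt_eqF m0).
Qed.

End kernel_average.

(** * Selections of a Young measure *)

Section young_selection.
Context d (T : measurableType d) (R : realType) (P : probability T R).
Context (C : set (set T)) (sC : sigma_algebra [set: T] C)
  (CA : C `<=` measurable) (coarse : mu_coarser P C).
Context (A : pmetricType R) (delta : young T R A).
Context (n : nat) (v : nat -> T -> A -> R) (h : nat -> T -> R).
Context (mv : forall j, measurable_fun setT (fun z : T * borel A => v j z.1 z.2)).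
Context (ih : forall j, intble P (h j)).
Context (vh : forall j w a, `|v j w a| <= h j w).
Implicit Types D : set (T * borel A).
Local Notation avg j := (average delta (v j)).

Lemma intble_average j D : measurable D -> intble P (avg j D).
Proof.
move=> mD; apply: (intble_le _ _ (ih j)); first exact: measurable_average.
by move=> w; exact: norm_average.
Qed.

(** The share of [delta w] lying in [U] is the weight that [conditional_lyapunov]
    turns into the set [E] of those [w] whose fibre is cut down to [U]; on the
    others it is cut down to the complement. The inclusions between [E]
    and the level sets of the weight keep all fibres non-null. *)
Lemma split_sections D (U : set (borel A)) : measurable D ->
  (forall w, 0 < mass delta D w) -> measurable U ->
  exists D', [/\ measurable D', (forall w, 0 < mass delta D' w),
    (forall w, section D' w `<=` section D w),
    (exists2 E : set T, measurable E & forall w,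
      (E w -> section D' w `<=` U) /\ (~ E w -> section D' w `<=` ~` U)) &
    forall j F, (j < n)%N -> C F -> setint P (avg j D') F = setint P (avg j D) F].
Proof.
move=> mD D0 mU; set D1 := D `&` (snd @^-1` U); set D2 := D `\` (snd @^-1` U).
have mU' : measurable (snd @^-1` U : set (T * borel A)).
  by rewrite -[X in measurable X]setTI; exact: measurable_snd.
have m1 : measurable D1 by exact: measurableI.
have m2 : measurable D2 by exact: measurableD.
pose lam w := mass delta D1 w / mass delta D w.
have lam1E w : lam w = 1 - mass delta D2 w / mass delta D w.
  rewrite /lam; have := D0 w; rewrite (mass_split delta w mD mU) -/D1 -/D2 => p0.
  by field; rewrite gt_eqF.
have lam01 w : 0 <= lam w <= 1.
  rewrite {1}/lam lam1E divr_ge0 ?mass_ge0//= gerBl divr_ge0 ?mass_ge0//.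
have mlam : measurable_fun setT lam.
  by apply: measurable_funM; [exact: measurable_mass|exact: measurable_massV].
have [E [mE E0 E1 HE]] := conditional_lyapunov sC CA coarse n
  (g := fun j w => avg j D1 w - avg j D2 w)
  (fun j => intbleB (intble_average j m1) (intble_average j m2)) mlam lam01.
have mE' : measurable (fst @^-1` E : set (T * borel A)).
  by rewrite -[X in measurable X]setTI; exact: measurable_fst.
pose D' := (D1 `&` (fst @^-1` E)) `|` (D2 `\` (fst @^-1` E)).
have sE w : section D' w = if w \in E then section D1 w else section D2 w.
  rewrite /section /D'; apply/seteqP; split => a /=.
    by case: ifPn; rewrite ?inE ?notin_setE /=; tauto.
  by case: ifPn; rewrite ?inE ?notin_setE /=; tauto.
have mD' : measurable D'.
  by apply: measurableU; [exact: measurableI|exact: measurableD].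
exists D'; split => //.
- move=> w; rewrite /mass sE; case: ifPn; rewrite ?inE ?notin_setE => Ew.
    have := E0 w Ew; rewrite /lam => l0; rewrite -/(mass delta D1 w).
    by move: l0; rewrite pmulr_lgt0// invr_gt0.
  rewrite -/(mass delta D2 w) lt_neqAle mass_ge0 andbT eq_sym.
  apply/negP => /eqP m0; apply: Ew; apply: E1.
  by rewrite lam1E m0 mul0r subr0.
- by move=> w; rewrite sE; case: ifPn => _ a [].
- exists E => // w; rewrite sE; split => [Ew|nEw].
    by rewrite mem_set// => a [].
  by rewrite memNset// => a [].
move=> j F jn CF; have mF := CA CF.
have i1 := intble_average j m1; have i2 := intble_average j m2.
have i12 := intbleB i1 i2.
have -> : avg j D' = (fun w => avg j D2 w +
    ((fun w => avg j D1 w - avg j D2 w) \_ E) w).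
  apply/funext => w; rewrite {1}/average /moment /mass sE patchE.
  by case: ifPn => _; [rewrite addrC subrK|rewrite addr0].
rewrite setintD//; last exact: intble_restr.
rewrite setint_restr HE// -setintD//; last first.
  apply: (intble_le _ _ (intble_norm i12)).
    by apply: measurable_funM => //; exact: intble_meas i12.
  move=> w; have /andP[l0 l1] := lam01 w.
  by rewrite normrM (ger0_norm l0) ler_piMl.
congr (setint P _ F); apply/funext => w.
by rewrite -(average_split (mv j) (vh j) mD mU (D0 w)).
Qed.

Context (cA : compact [set: A]).
Context (cv : forall j w, continuous (v j w)).

(** Split successively along a countable base [B]. If [f w] lies in the closure of
    all fibres and in the open set [B j], the fibre cannot have been cut to the
    complement of [B j], so the fibres shrink to [f w]: their averages converge
    to [v j w (f w)], and every neighbourhood of [f w] contains a fibre, hence is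
    non-null for [delta w]. *)
Lemma young_selection : exists f : T -> A,
  [/\ measurable_fun setT (f : T -> borel A),
      (forall w, supp (delta w) (f w)),
      (forall j, intble P (fun w => v j w (f w))) /\
      (forall j, intble P (fun w => \int[delta w]_a v j w a)) &
      forall j F, (j < n)%N -> C F ->
        setint P (fun w => v j w (f w)) F =
        setint P (fun w => \int[delta w]_a v j w a) F].
Proof.
have [B [oB bB]] := compact_countable_base cA.
have mB j : measurable (B j : set (borel A)) by exact: sub_sigma_algebra.
pose inv D := measurable D /\ forall w, 0 < mass delta D w.
have next j D : {D' | inv D -> [/\ inv D',
    (forall w, section D' w `<=` section D w),
    (exists2 E : set T, measurable E & forall w,
      (E w -> section D' w `<=` B j) /\ (~ E w -> section D' w `<=` ~` B j)) &
    forall i F, (i < n)%N -> C F -> setint P (avg i D') F = setint P (avg i D) F]}.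
  apply: cid; have [b|nb] := pselect (inv D); last by exists D.
  have [D' [? ? ? ? ?]] := split_sections b.1 b.2 (mB j).
  by exists D' => _; split.
pose D := fix D k := if k is k'.+1 then sval (next k' (D k')) else setT.
have Dinv k : inv (D k).
  elim: k => [|k IH]; last by case: (svalP (next k (D k)) IH).
  by split; [exact: measurableT|move=> w; rewrite massT].
have step k := svalP (next k (D k)) (Dinv k).
have secni w i j : (i <= j)%N -> section (D j) w `<=` section (D i) w.
  elim: j => [|j IHj]; first by rewrite leqn0 => /eqP ->.
  rewrite leq_eqVlt => /orP[/eqP -> //|]; rewrite ltnS => /IHj ij.
  by apply: (subset_trans _ ij); have [_ H _ _] := step j; exact: H.
have sec0 w k : section (D k) w !=set0.
  apply/set0P/negP => /eqP s0; have := (Dinv k).2 w.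
  by rewrite /mass s0 measure0 ltxx.
have pt w := nested_closure_point cA (sec0 w) (secni w).
pose f w := sval (cid (pt w)).
have fcl w k : closure (section (D k) w) (f w) := svalP (cid (pt w)) k.
have shrink w O : nbhs (f w) O -> exists k0, forall k, (k0 <= k)%N ->
    section (D k) w `<=` O.
  move=> /bB[j Bf BO]; exists j.+1 => k jk.
  apply: (subset_trans (secni w _ _ jk)); apply: (subset_trans _ BO).
  have [_ _ [E mE HE] _] := step j; have [h1 h2] := HE w.
  have [/h1 //|/h2 h3] := pselect (E w).
  have [a [Da Ba]] := fcl w j.+1 _ (open_nbhs_nbhs (conj (oB j) Bf)).
  by have := h3 a Da.
have mf : measurable_fun setT (f : T -> borel A).
  apply: (@measurability _ _ T (borel A) setT f (@open A)) => // _ [ O oO <-]; rewrite setTI.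
  have stepE j : exists2 E : set T, measurable E & forall w,
      (E w -> section (D j.+1) w `<=` B j) /\ (~ E w -> section (D j.+1) w `<=` ~` B j).
    by case: (step j).
  pose E j := sval (cid2 (stepE j)).
  have [mE HE] : (forall j, measurable (E j)) /\
    (forall j w, (E j w -> section (D j.+1) w `<=` B j) /\
      (~ E j w -> section (D j.+1) w `<=` ~` B j)).
    by split => j; rewrite /E; case: (cid2 _).
  (* closures are needed because a fibre inside [B j] only puts [f w] in the
     closure of [B j] *)
  rewrite (_ : f @^-1` O = \bigcup_(j in [set j | closure (B j) `<=` O]) E j).
    by apply: bigcup_measurable.
  apply/seteqP; split => w /=.
    move=> Of; have : nbhs (f w) O by exact: open_nbhs_nbhs.
    move=> /(@uniform_regular A)[N /bB[j Bf BN] NO].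
    exists j; first by apply: subset_trans NO; exact: closure_subset.
    apply: contrapT => /(HE j w).2 h3.
    have [a [Da Ba]] := fcl w j.+1 _ (open_nbhs_nbhs (conj (oB j) Bf)).
    by have := h3 a Da.
  move=> [j BO /(HE j w).1 h1]; apply: BO.
  exact: (closure_subset h1 (fcl w j.+1)).
have lim j w : (fun k => avg j (D k) w) @ \oo --> v j w (f w).
  apply/cvgrPdist_le => e e0.
  have : nbhs (f w) [set a | `|v j w (f w) - v j w a| <= e].
    by have /cvgrPdist_le := @cv j w (f w); exact.
  move=> /shrink[k0 hk]; exists k0 => // k /hk sO /=.
  have [mDk Dk0] := Dinv k.
  rewrite distrC ler_distl; apply/andP; split.
    apply: (average_ge (mv j) (vh j) mDk (Dk0 w)) => a /sO /=.
    by rewrite ler_distl => /andP[]; lra.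
  apply: (average_le (mv j) (vh j) mDk (Dk0 w)) => a /sO /=.
  by rewrite ler_distl => /andP[]; lra.
have dom j := setint_dominated (fun k => measurable_average delta (mv j) (Dinv k).1)
  (ih j) (fun k w => norm_average delta (mv j) (vh j) w (Dinv k).1) (lim j).
exists f; split => //.
- move=> w U oU Uf; have /shrink[k sU] : nbhs (f w) U by exact: open_nbhs_nbhs.
  have [mDk /(_ w) Dk0] := Dinv k.
  apply: (@lt_le_trans _ _ (delta w (section (D k) w))).
    by rewrite -massE// lte_fin.
  apply: le_measure; rewrite ?inE//; [exact: measurable_section| |exact: sU].
  exact: sub_sigma_algebra.
- split=> j; first by case: (dom j).
  rewrite (_ : (fun w => _) = avg j setT); first exact: intble_average.
  by apply/funext => w; rewrite averageT.
- move=> j F jn CF; have c := (dom j).2 F (CA CF).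
  have const k : setint P (avg j (D k)) F =
      setint P (fun w => \int[delta w]_a v j w a) F.
    elim: k => [|k <-]; last by have [_ _ _ H] := step k; exact: H.
    by congr (setint P _ F); apply/funext => w; exact: averageT.
  apply/eqP; rewrite eq_le; apply/andP; split.
    by apply: (cvgr_to_le c); apply: nearW => k; rewrite const.
  by apply: (cvgr_to_ge c); apply: nearW => k; rewrite const.
Qed.

End young_selection.

(** The chosen version depends on the function only through the set of all its
    versions, so here equality holds everywhere. *)
Lemma condexp_eq d (T : measurableType d) (R : realType) (P : probability T R)
    (C : set (set T)) (X Y : T -> R) : C `<=` measurable ->
  intble P X -> intble P Y -> (forall F, C F -> setint P X F = setint P Y F) ->
  condexp P C X = condexp P C Y.
Proof.
move=> CA iX iY XY; congr xget; apply/seteqP.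
have setintE Z B : C B -> intble P Z ->
    (\int[P]_(w in B) (Z w)%:E)%E = (setint P Z B)%:E.
  move=> CB iZ; rewrite /setint /Rintegral fineK//; apply: integrable_fin_num.
    exact: CA.
  by apply: intbleS => //; exact: CA.
by split => Z [mZ iZ ZE]; split => // B CB; rewrite ZE// !setintE// XY.
Qed.

Theorem corollary3 (d : measure_display) (T : measurableType d) (R : realType)
  (P : probability T R) (A : pmetricType R) (n : nat)
  (V : T -> A -> 'rV[R]_n) (C : set (set T)) (delta : young T R A) :
  measure_is_complete P ->
  compact [set: A] ->
  (1 <= n)%N ->
  (forall a : A, measurable_fun [set: T] (fun w => V w a : borel 'rV[R]_n)) ->
  (forall w : T, continuous (V w)) ->
  (forall i : 'I_n, L1_bounded P (fun w a => V w a ord0 i)) ->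
  sigma_algebra [set: T] C ->
  C `<=` measurable ->
  mu_coarser P C ->
  exists f : T -> A,
    [/\ measurable_fun [set: T] (f : T -> borel A),
        {ae P, forall w, vcondexp P C (young_app delta V) w =
                         vcondexp P C (fun w' => V w' (f w')) w} &
        {ae P, forall w, supp (delta w) (f w)}].
Proof.
move=> _ cA _ mV cV bV sC CA coarse.
(* coordinates indexed by [nat], extended by zero *)
pose v j w a := if insub j is Some i then V w a ord0 i else 0.
have vE (i : 'I_n) w a : v i w a = V w a ord0 i by rewrite /v valK.
pose h j := if insub j is Some i then sval (cid (bV i)) else cst 0.
have ih j : intble P (h j).
  rewrite /h; case: insub => [i|]; last exact: intble_cst.
  by case: cid => ? [].
have vh j w a : `|v j w a| <= h j w.
  rewrite /v /h; case: insub => [i|]; last by rewrite normr0.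
  by case: cid => ? [].
have cv j w : continuous (v j w).
  rewrite /v; case: insub => [i|]; last exact: cst_continuous.
  move=> a; apply: (@continuous_comp _ _ _ (V w) (fun M : 'rV[R]_n => M ord0 i)).
    exact: cV.
  exact: coord_continuous.
have mva j a : measurable_fun setT (v j ^~ a).
  rewrite /v; case: insub => [i|]; last exact: measurable_cst.
  apply: (@measurableT_comp _ _ _ _ _ _ (fun M : borel 'rV[R]_n => M ord0 i)).
    apply: (measurability _ (RGenOpens.measurableE R)).
    move=> _ [_ [x [y ->] <-]]; rewrite setTI; apply: sub_sigma_algebra.
    have /continuousP := @coord_continuous R 1 n ord0 i; apply.
    exact: interval_open.
  exact: mV.
have mv j := caratheodory_measurable cA (mva j) (cv j).
have [f [mf fs [ivf ivd] fV]] :=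
  young_selection sC CA coarse delta n mv ih vh cA cv.
exists f; split => //; last exact: aeW.
apply: aeW => w; apply/rowP => i; rewrite !mxE.
congr (_ w); apply: condexp_eq => //.
- rewrite (_ : (fun w' => _) = (fun w' => \int[delta w']_a v i w' a)) //.
  apply/funext => w'; rewrite mxE; apply: eq_Rintegral => a _.
  by rewrite vE.
- rewrite (_ : (fun w' => _) = (fun w' => v i w' (f w'))) //.
  by apply/funext => w'; rewrite vE.
- move=> F CF; transitivity (setint P (fun w' => \int[delta w']_a v i w' a) F).
    congr (setint P _ F); apply/funext => w'; rewrite mxE.
    by apply: eq_Rintegral => a _; rewrite vE.
  rewrite -fV//; congr (setint P _ F); apply/funext => w'; exact: vE.
Qed.
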